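(* For any family of cost tensors $C\in(\mathbb{R}^n)^{\otimes k}$ and accuracy $\varepsilon>0$, $\mathtt{SINKHORN}$ solves $\mathsf{MOT}_C$ to $\varepsilon$ accuracy in $\mathrm{poly}(n,k,C_{\max}/\varepsilon)$ time and $\mathrm{poly}(n,k,C_{\max}/\varepsilon)$ calls to the $\mathsf{SMIN}_C$ oracle with regularization $\eta=(2k\log n)/\varepsilon$. (The solution is output through a polynomial-size implicit representation, namely via vectors $d_1,\dots,d_k,v_1,\dots,v_k\in\mathbb{R}^n_{\ge0}$ representing $P=(\otimes_{i=1}^kd_i)\odot\exp[-\eta C]+\otimes_{i=1}^kv_i$.)
   Context: Conventions: $[n]=\{1,\dots,n\}$; $\Delta_n$ is the probability simplex; $\vec{j}=(j_1,\dots,j_k)\in[n]^k$; $C_{\max}=\max_{\vec{j}}|C_{\vec{j}}|$; $[m_i(P)]_j=\sum_{\vec{j}:\,j_i=j}P_{\vec{j}}$; $\odot$ is the entrywise product, $\otimes$ the Kronecker (tensor) product, $\exp[\cdot]$ is applied entrywise; $\bar{\mathbb{R}}=\mathbb{R}\cup\{-\infty\}$. Input entries have bit complexity at most $\mathrm{poly}(n,k)$; runtimes count arithmetic operations. $\mathsf{MOT}_C$ problem: given $\mu=(\mu_1,\dots,\mu_k)\in(\Delta_n)^k$, solve $\min\langle P,C\rangle$ over $\mathcal{M}(\mu_1,\dots,\mu_k)=\{P\in(\mathbb{R}_{\ge0}^n)^{\otimes k}: m_i(P)=\mu_i\ \forall i\}$. Solving to $\varepsilon$ accuracy means producing a feasible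 $P$ with $\langle C,P\rangle$ at most $\varepsilon$ more than optimal. $\mathsf{SMIN}_C$ oracle: given $p=(p_1,\dots,p_k)\in\bar{\mathbb{R}}^{n\times k}$ and $\eta>0$, return $-\frac1\eta\log\sum_{\vec{j}\in[n]^k}\exp\big(-\eta(C_{\vec{j}}-\sum_{i=1}^k[p_i]_{j_i})\big)$, with conventions $e^{-\infty}=0$, $\log0=-\infty$. $\mathtt{SINKHORN}$: let $\mathsf{MARG}_C(d,\eta,i)=m_i((\otimes_{i'=1}^kd_{i'})\odot\exp[-\eta C])$. Step 1: set all $d_i\leftarrow\mathbf{1}$, $\eta\leftarrow(2k\log n)/\varepsilon$; for $\mathrm{poly}(n,k,C_{\max}/\varepsilon)$ iterations: choose $i\in[k]$ (round-robin, greedily or randomly), $\tilde\mu_i\leftarrow\mathsf{MARG}_C(d,\eta,i)$, $d_i\leftarrow d_i\odot(\mu_i/\tilde\mu_i)$. Step 2: for $i=1,\dots,k$: $\tilde\mu_i\leftarrow\mathsf{MARG}_C(d,\eta,i)$, $d_i\leftarrow d_i\odot\min[\mathbf{1},\mu_i/\tilde\mu_i]$ (entrywise). Then $v_i\leftarrow\mu_i-\mathsf{MARG}_C(d,\eta,i)$ for each $i$, and $v_1\leftarrow v_1/\|v_1\|_1^{k-1}$. Return $d_1,\dots,d_k,v_1,\dots,v_k$. The $\mathsf{MARG}_C$ computations are carried out via calls to $\mathsf{SMIN}_C$. *)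

(* Defs.v *)
From HB Require Import structures.
From mathcomp Require Import all_boot all_order all_algebra.
From mathcomp Require Import all_classical all_reals all_analysis.

Set Implicit Arguments.
Unset Strict Implicit.
Unset Printing Implicit Defensive.

Import Order.TTheory GRing.Theory Num.Theory.
Local Open Scope classical_set_scope.
Local Open Scope ring_scope.

Definition tensor (R : Type) (n k : nat) := {ffun 'I_k -> 'I_n} -> R.

Section MOT.
Variables (R : realType) (n k : nat).
Implicit Types (C P : tensor R n k) (mu d v : 'I_k -> 'I_n -> R).

Definition in_simplex (x : 'I_n -> R) : Prop :=
  (forall j, 0 <= x j) /\ \sum_j x j = 1.

Definition cmax C : R := \big[Num.max/0]_j `|C j|.

Definition inner C P : R := \sum_j C j * P j.

Definition marginal P (i : 'I_k) (l : 'I_n) : R :=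
  \sum_(j : {ffun 'I_k -> 'I_n} | j i == l) P j.

Definition couplings mu : set (tensor R n k) :=
  [set P | (forall j, 0 <= P j) /\ forall i l, marginal P i l = mu i l].

Definition mot_value C mu : R := inf [set inner C P | P in couplings mu].

Definition mot_solution C mu (eps : R) P : Prop :=
  couplings mu P /\ inner C P <= mot_value C mu + eps.

(* The weights [p] range over the reals with -oo; the value is +oo exactly when
   the sum vanishes. [expeR -oo = 0] and [lne 0 = -oo] in the library. *)
Definition smin C (p : 'I_k -> 'I_n -> \bar R) (eta : R) : \bar R :=
  (- ((eta^-1)%:E *
      lne (\sum_(j : {ffun 'I_k -> 'I_n})
             expeR (- (eta%:E * ((C j)%:E - \sum_(i < k) p i (j i))))))%E)%E.

Definition represented C (eta : R) d v : tensor R n k := fun j =>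
  (\prod_i d i (j i)) * expR (- eta * C j) + \prod_i v i (j i).

End MOT.

(* Real programs with access to a softmin oracle. [V] is the type
   of machine numbers: programs are written uniformly in [V], so the only way
   for them to compute with numbers is through the instructions below. In an
   oracle query [None] stands for -oo; in an answer it stands for +oo. *)
Variant op1 := Abs | Exp | Ln.
Variant op2 := Add | Sub | Mul | Div | Min.

Inductive prog (V : Type) (n k : nat) (A : Type) : Type :=
| Ret of A
| Cst of nat & (V -> prog V n k A)
| Op1 of op1 & V & (V -> prog V n k A)
| Op2 of op2 & V & V & (V -> prog V n k A)
| Less of V & V & (bool -> prog V n k A)
| Smin of ('I_k -> 'I_n -> option V) & V & (option V -> prog V n k A).

Arguments Ret {V n k A}.
Arguments Cst {V n k A}.
Arguments Op1 {V n k A}.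
Arguments Op2 {V n k A}.
Arguments Less {V n k A}.
Arguments Smin {V n k A}.

Fixpoint bind (V : Type) (n k : nat) (A B : Type) (m : prog V n k A)
    (f : A -> prog V n k B) : prog V n k B :=
  match m with
  | Ret a => f a
  | Cst c g => Cst c (fun x => bind (g x) f)
  | Op1 o x g => Op1 o x (fun y => bind (g y) f)
  | Op2 o x y g => Op2 o x y (fun z => bind (g z) f)
  | Less x y g => Less x y (fun b => bind (g b) f)
  | Smin p eta g => Smin p eta (fun y => bind (g y) f)
  end.

Notation "'let!' x := m 'in' f" := (bind m (fun x => f))
  (at level 200, x name, m at level 200, f at level 200).

Section Semantics.
Variables (R : realType) (n k : nat).

Definition eval1 (o : op1) (x : R) : R :=
  match o with Abs => `|x| | Exp => expR x | Ln => ln x end.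

(* Division is total with [x / 0 = 0]. *)
Definition eval2 (o : op2) (x y : R) : R :=
  match o with
  | Add => x + y | Sub => x - y | Mul => x * y | Div => x / y
  | Min => Num.min x y
  end.

Definition ext_of (x : option R) : \bar R :=
  if x is Some r then r%:E else (-oo)%E.

Definition answer_of (x : \bar R) : option R :=
  if x is EFin r then Some r else None.

(* [ops]: number of arithmetic operations and comparisons;
   [etas]: regularization parameters of the successive oracle calls. *)
Record outcome (A : Type) := Outcome { value : A; ops : nat; etas : seq R }.

Definition tick (A : Type) (r : outcome A) : outcome A :=
  Outcome (value r) (ops r).+1 (etas r).

Definition called (A : Type) (eta : R) (r : outcome A) : outcome A :=
  Outcome (value r) (ops r) (eta :: etas r).

Fixpoint run (C : tensor R n k) (A : Type) (m : prog R n k A) : outcome A :=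
  match m with
  | Ret a => Outcome a 0 [::]
  | Cst c f => tick (run C (f c%:R))
  | Op1 o x f => tick (run C (f (eval1 o x)))
  | Op2 o x y f => tick (run C (f (eval2 o x y)))
  | Less x y f => tick (run C (f (x < y)))
  | Smin p eta f =>
      called eta
        (run C (f (answer_of (smin C (fun i l => ext_of (p i l)) eta))))
  end.

Definition cost_le (A : Type) (eta B : R) (r : outcome A) : Prop :=
  [/\ (ops r)%:R <= B, (size (etas r))%:R <= B & all (pred1 eta) (etas r)].

End Semantics.

(* The criteria for greedy selection: l1 distance, or the Kullback-Leibler
   divergence of [mu] from [m] extended to nonnegative [m] of any mass,
   [\sum_j (m j - mu j + mu j * ln (mu j / m j))]. *)
Variant discrepancy := L1 | KL.

Variant rule (k : nat) :=
| Schedule of (nat -> 'I_k)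
| Greedy of discrepancy.

Arguments Greedy {k}.

Definition round_robin (k : nat) (k_gt0 : (0 < k)%N) : rule k :=
  Schedule (fun t => Ordinal (ltn_pmod t k_gt0)).

Definition drawn (k : nat) (k_gt0 : (0 < k)%N) (T : nat)
    (w : T.-tuple 'I_k) : rule k :=
  Schedule (fun t => nth (Ordinal k_gt0) w t).

Section Sinkhorn.
Variables (V : Type) (n k : nat).
Local Notation M := (prog V n k).
Local Notation vec := ('I_n -> V).

Definition numeral (c : nat) : M V := Cst c Ret.
Definition un (o : op1) (x : V) : M V := Op1 o x Ret.
Definition bin (o : op2) (x y : V) : M V := Op2 o x y Ret.

Fixpoint tabulate (A : Type) (m : nat) : ('I_m -> M A) -> M ('I_m -> A) :=
  match m with
  | 0 => fun _ => Ret (fun i : 'I_0 => False_rect A (notF (ltn_ord i)))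
  | m'.+1 => fun f =>
      let! x := f ord0 in
      let! g := tabulate (fun i => f (lift ord0 i)) in
      Ret (fun i => if unlift ord0 i is Some i' then g i' else x)
  end.

Fixpoint foldM (A B : Type) (f : B -> A -> M B) (b : B) (s : seq A) : M B :=
  if s is a :: s' then (let! b' := f b a in foldM f b' s') else Ret b.

Definition sumM (m : nat) (x : 'I_m -> V) : M V :=
  let! z := numeral 0 in foldM (fun acc i => bin Add acc (x i)) z (enum 'I_m).

Fixpoint powM (x : V) (m : nat) : M V :=
  if m is m'.+1 then (let! y := powM x m' in bin Mul x y) else numeral 1.

Definition zipM (o : op2) (x y : vec) : M vec :=
  tabulate (fun j => bin o (x j) (y j)).

Definition update (d : 'I_k -> vec) (i : 'I_k) (x : vec) : 'I_k -> vec :=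
  fun i' => if i' == i then x else d i'.

Definition log_weight (eta x : V) : M (option V) :=
  let! z := numeral 0 in
  Less z x (fun pos =>
    if pos then
      let! l := un Ln x in
      let! y := bin Div l eta in
      Ret (Some y)
    else Ret None).

(* Entry [l] of MARG_C(d, eta, i) is the total mass of the scaled tensor once
   [d i] is zeroed outside [l], that is exp(- eta * SMIN_C(p, eta)) for
   p = (log d) / eta, with p i l' = -oo when l' != l. *)
Definition marg (eta : V) (d : 'I_k -> vec) (i : 'I_k) : M vec :=
  tabulate (fun l : 'I_n =>
    let! p := tabulate (fun i' : 'I_k => tabulate (fun l' : 'I_n =>
                if (i' == i) && (l' != l) then Ret None
                else log_weight eta (d i' l'))) in
    Smin p eta (fun s =>
      if s is Some y then
        let! z := numeral 0 in
        let! neta := bin Sub z eta in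
        let! y' := bin Mul neta y in
        un Exp y'
      else numeral 0)).

Definition disc (D : discrepancy) (mu m : vec) : M V :=
  let! terms := tabulate (fun j : 'I_n =>
    match D with
    | L1 => let! x := bin Sub (m j) (mu j) in un Abs x
    | KL => let! x := bin Sub (m j) (mu j) in
            let! q := bin Div (mu j) (m j) in
            let! l := un Ln q in
            let! y := bin Mul (mu j) l in
            bin Add x y
    end) in
  sumM terms.

Variable k_gt0 : (0 < k)%N.
Local Notation i0 := (Ordinal k_gt0).

Definition select (rl : rule k) (eta : V) (mu d : 'I_k -> vec) (t : nat)
    : M 'I_k :=
  match rl with
  | Schedule s => Ret (s t)
  | Greedy D =>
      let! e := tabulate (fun i : 'I_k =>
                  let! m := marg eta d i in disc D (mu i) m) in
      foldM (fun best i => Less (e best) (e i)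
                             (fun b => Ret (if b then i else best)))
            i0 (enum 'I_k)
  end.

(* A vanishing entry of the computed marginal only occurs where [d i] already
   vanishes, so the total division keeps that entry of [d i] equal to 0. *)
Definition scaling_step (rl : rule k) (eta : V) (mu d : 'I_k -> vec) (t : nat)
    : M ('I_k -> vec) :=
  let! i := select rl eta mu d t in
  let! m := marg eta d i in
  let! q := zipM Div (mu i) m in
  let! x := zipM Mul (d i) q in
  Ret (update d i x).

Definition rounding_step (eta : V) (mu d : 'I_k -> vec) (i : 'I_k)
    : M ('I_k -> vec) :=
  let! m := marg eta d i in
  let! q := zipM Div (mu i) m in
  let! one := numeral 1 in
  let! q1 := zipM Min (fun _ => one) q in
  let! x := zipM Mul (d i) q1 in
  Ret (update d i x).

(* When the residual [v i0] is 0, the total division leaves it equal to 0,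
   and the rank-one correction vanishes. *)
Definition sinkhorn (T : nat) (rl : rule k) (eps : V) (mu : 'I_k -> vec)
    : M (('I_k -> vec) * ('I_k -> vec)) :=
  let! a := numeral (2 * k) in
  let! N := numeral n in
  let! logn := un Ln N in
  let! b := bin Mul a logn in
  let! eta := bin Div b eps in
  let! one := numeral 1 in
  let! d1 := foldM (scaling_step rl eta mu) (fun _ _ => one) (iota 0 T) in
  let! d2 := foldM (rounding_step eta mu) d1 (enum 'I_k) in
  let! v := tabulate (fun i : 'I_k =>
              let! m := marg eta d2 i in zipM Sub (mu i) m) in
  let! absv := tabulate (fun j : 'I_n => un Abs (v i0 j)) in
  let! s := sumM absv in
  let! r := powM s k.-1 in
  let! v1 := zipM Div (v i0) (fun _ => r) in
  Ret (d2, update v i0 v1).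

End Sinkhorn.

Section Guarantee.
Variable R : realType.

(* As [n, k >= 1], a function of [n, k, x >= 0] is bounded by a polynomial iff
   it is bounded by [poly_bound c] for some [c]. *)
Definition poly_bound (c n k : nat) (x : R) : R :=
  c%:R * (n%:R + k%:R + x) ^+ c.

Definition solves (n k : nat) (C : tensor R n k) (mu : 'I_k -> 'I_n -> R)
    (eps eta : R) (out : ('I_k -> 'I_n -> R) * ('I_k -> 'I_n -> R)) : Prop :=
  let (d, v) := out in
  [/\ forall i l, 0 <= d i l, forall i l, 0 <= v i l
    & mot_solution C mu eps (represented C eta d v)].

Definition unif_pr (W : finType) (E : W -> Prop) : R :=
  #|[set w : W | `[< E w >]]%SET|%:R / #|W|%:R.

End Guarantee.

(* Main.v *)
Require Import Defs.
From mathcomp Require Import all_boot all_order all_algebra.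
From mathcomp Require Import all_classical all_reals all_analysis.
From mathcomp Require Import ring lra zify.

(** Scaling one index of [d] until its marginal is correct is a projection in
relative entropy: for every coupling [Q], the divergence [kl Q (gibbs C eta d)]
drops by exactly the divergence between the prescribed and the current marginal
([kl_scale]). The first step brings this potential below
[(k + 1) * ln n + 2 * eta * cmax C] ([kl_first]), and it stays nonnegative, so
among polynomially many blocks of iterations there is one over which it hardly
moves. If that block selects every index, as it does for a cyclic order and,
with high probability, for random draws, then all marginals are nearly correct
at its beginning ([covering_small_error]); for the greedy rules a block of
length one suffices ([greedy_small_error]).

The iterate found in this way need not be the last one, and the errors of the
marginals are not monotone. What saves the last iterate is that rounding is
cheap in relative entropy and not only in norm: the entries of a scaled tensor
are at least a product of its prescribed marginals, up to a factor whose
logarithm is polynomial ([balanced_lower_bound]), so the rank-one correction,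
which has small mass, adds little divergence ([kl_rounded]). Rounding the good
iterate thus gives a coupling [Q] of small divergence from it. Later steps only
decrease the divergence of [Q], hence the last iterate is close to [Q] in norm
by an inequality of Pinsker type, and its marginals are nearly correct as well
([errors_stay_small]).

Finally the divergences of two couplings from one scaled tensor differ by [eta]
times the difference of their costs, up to their entropies ([kl_gibbs]). The
rounding of the last iterate has small divergence and an entropy of at most
[k * ln n], which is [eta * eps / 2]; so its cost is within [eps] of that of any
coupling ([rounded_optimal]). With one state the regularization parameter
vanishes and the run is followed directly ([solves_one_state]).

All quantitative requirements are expressed in powers of one natural number [N]
that dominates [n + k] and [cmax C / eps]. *)

Set Implicit Arguments.
Unset Strict Implicit.
Unset Printing Implicit Defensive.

Import Order.TTheory GRing.Theory Num.Theory.
Local Open Scope ring_scope.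

(** * Values computed by programs *)

Section Programs.
Variables (R : realType) (n k : nat) (C : tensor R n k).
Local Notation M := (prog R n k).
Local Notation vec := ('I_n -> R).

Definition result (A : Type) (m : M A) : A := value (run C m).

Lemma run_bind (A B : Type) (m : M A) (f : A -> M B) :
  [/\ result (bind m f) = result (f (result m)),
      ops (run C (bind m f)) = (ops (run C m) + ops (run C (f (result m))))%N
    & etas (run C (bind m f)) = etas (run C m) ++ etas (run C (f (result m)))].
Proof.
rewrite /result; elim: m => [a|c g IH|o x g IH|o x y g IH|x y g IH|p e g IH] //=;
  by [case: (IH (c%:R)) => -> -> -> | case: (IH (eval1 o x)) => -> -> ->
     | case: (IH (eval2 o x y)) => -> -> -> | case: (IH (x < y)) => -> -> ->
     | case: (IH (answer_of (smin C (fun i l => ext_of (p i l)) e)))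
         => -> -> ->].
Qed.

Lemma result_bind (A B : Type) (m : M A) (f : A -> M B) :
  result (bind m f) = result (f (result m)).
Proof. by case: (run_bind m f). Qed.

Lemma result_tabulate (A : Type) (m : nat) (f : 'I_m -> M A) :
  result (tabulate f) = fun i => result (f i).
Proof.
apply/funext; elim: m f => [|m IH] f i; first by case: i.
rewrite /= !result_bind /= [LHS]/result /=.
case: unliftP => [j|] ->; last by [].
exact: IH.
Qed.

Lemma result_foldM (A B : Type) (f : B -> A -> M B) b (s : seq A) :
  result (foldM f b s) = foldl (fun b a => result (f b a)) b s.
Proof. by elim: s b => [|a s IH] b //=; rewrite result_bind IH. Qed.

Lemma result_sumM (m : nat) (x : 'I_m -> R) :
  result (sumM n k x) = \sum_(i < m) x i.
Proof.
rewrite /sumM result_bind result_foldM -(big_enum _ _ _ (fun i => x i)) /=.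
have foldlD (s : seq 'I_m) (z : R) :
    foldl (fun b i => b + x i) z s = z + \sum_(i <- s) x i.
  elim: s z => [|i s IH] z /=; first by rewrite big_nil addr0.
  by rewrite IH big_cons addrA.
by rewrite [LHS]foldlD add0r.
Qed.

Lemma result_powM (x : R) (m : nat) : result (powM n k x m) = x ^+ m.
Proof.
by elim: m => [|m IH] //=; rewrite result_bind IH exprS.
Qed.

Lemma result_zipM o (x y : vec) :
  result (zipM k o x y) = fun l => eval2 o (x l) (y l).
Proof. by rewrite /zipM result_tabulate. Qed.

(** * Cost of programs *)

(** Operations and oracle calls are added up because the final bound is the
same for both. *)
Definition frugal (eta : R) (N : nat) (A : Type) (m : M A) : Prop :=
  (ops (run C m) + size (etas (run C m)) <= N)%N
  /\ all (pred1 eta) (etas (run C m)).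

Lemma frugal_leq eta N N' (A : Type) (m : M A) :
  (N <= N')%N -> frugal eta N m -> frugal eta N' m.
Proof. by move=> NN' [? ?]; split=> //; apply: leq_trans NN'. Qed.

Lemma frugal_ret eta (A : Type) (a : A) : frugal eta 0 (Ret a : M A).
Proof. by []. Qed.

Lemma frugal_bind eta N1 N2 (A B : Type) (m : M A) (f : A -> M B) :
  frugal eta N1 m -> (forall a, frugal eta N2 (f a)) ->
  frugal eta (N1 + N2) (bind m f).
Proof.
move=> [c1 e1] /(_ (result m)) [c2 e2]; case: (run_bind m f) => _ o e; split.
  by rewrite o e size_cat addnACA leq_add.
by rewrite e all_cat e1.
Qed.

Lemma frugal_map eta N (A B : Type) (g : A -> B) (m : M A) :
  frugal eta N m -> frugal eta N (bind m (fun a => Ret (g a))).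
Proof.
move=> mP; apply: (@frugal_leq _ (N + 0)); first by rewrite addn0.
exact: frugal_bind.
Qed.

Lemma frugal_tabulate eta N (A : Type) (m : nat) (f : 'I_m -> M A) :
  (forall i, frugal eta N (f i)) -> frugal eta (m * N) (tabulate f).
Proof.
elim: m f => [|m IH] f fP //=; rewrite mulSn.
by apply: frugal_bind => // x; apply/frugal_map/IH.
Qed.

Lemma frugal_foldM eta N m (A B : Type) (f : B -> A -> M B) b (s : seq A) :
  size s = m -> (forall b a, frugal eta N (f b a)) ->
  frugal eta (m * N) (foldM f b s).
Proof.
move=> <- fP; elim: s b => [|a s IH] b //=; rewrite mulSn.
by apply: frugal_bind.
Qed.

Lemma frugal_numeral eta c : frugal eta 1 (numeral R n k c).
Proof. by []. Qed.

Lemma frugal_un eta o x : frugal eta 1 (un n k o (x : R)).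
Proof. by []. Qed.

Lemma frugal_bin eta o x y : frugal eta 1 (bin n k o (x : R) y).
Proof. by []. Qed.

(** These rules keep the operands in view: the regularization parameter that
later oracle calls must use is itself computed by such instructions. *)
Lemma frugal_numeral_bind eta N c (A : Type) (f : R -> M A) :
  frugal eta N (f c%:R) -> frugal eta N.+1 (bind (numeral R n k c) f).
Proof. by []. Qed.

Lemma frugal_un_bind eta N o x (A : Type) (f : R -> M A) :
  frugal eta N (f (eval1 o x)) -> frugal eta N.+1 (bind (un n k o x) f).
Proof. by []. Qed.

Lemma frugal_bin_bind eta N o x y (A : Type) (f : R -> M A) :
  frugal eta N (f (eval2 o x y)) -> frugal eta N.+1 (bind (bin n k o x y) f).
Proof. by []. Qed.

Lemma frugal_sumM eta (m : nat) (x : 'I_m -> R) : frugal eta m.+1 (sumM n k x).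
Proof.
rewrite -add1n; apply: frugal_bind; first by [].
move=> z; apply: (@frugal_leq eta (m * 1)); first by rewrite muln1.
by apply: frugal_foldM; first exact: size_enum_ord.
Qed.

Lemma frugal_powM eta x m : frugal eta m.+1 (powM n k (x : R) m).
Proof.
elim: m => [|m IH] //=.
by rewrite -addn1; apply: frugal_bind.
Qed.

Lemma frugal_zipM eta o (x y : vec) : frugal eta n (zipM k o x y).
Proof.
apply: (@frugal_leq eta (n * 1)); first by rewrite muln1.
by apply: frugal_tabulate => *; apply: frugal_bin.
Qed.

Lemma frugal_log_weight eta x : frugal eta 4 (log_weight n k eta (x : R)).
Proof. by rewrite /log_weight /frugal /=; case: ifP. Qed.

Lemma frugal_marg eta (d : 'I_k -> vec) i :
  frugal eta (n * (k * (n * 4) + 5)) (marg eta d i).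
Proof.
apply: frugal_tabulate => l; apply: frugal_bind.
  apply: frugal_tabulate => i'; apply: frugal_tabulate => l'.
  by case: ifP => _; [apply: (@frugal_leq eta 0) | exact: frugal_log_weight].
by move=> p; rewrite /frugal /=; case: answer_of => [a|] /=; rewrite eqxx.
Qed.

Lemma frugal_disc eta D mu (m : vec) : frugal eta (n * 5 + n.+1) (disc k D mu m).
Proof.
apply: frugal_bind => [|t]; last exact: frugal_sumM.
by apply: frugal_tabulate => j; case: D.
Qed.

Variable k_gt0 : (0 < k)%N.

Let step_cost := (k * (n * (k * (n * 4) + 5) + (n * 5 + n.+1)) + k * 1
  + (n * (k * (n * 4) + 5) + (n + n)))%N.

Lemma frugal_select eta rl mu (d : 'I_k -> vec) t :
  frugal eta (k * (n * (k * (n * 4) + 5) + (n * 5 + n.+1)) + k * 1)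
    (select k_gt0 rl eta mu d t).
Proof.
case: rl => [s|D] /=; first by apply: (@frugal_leq eta 0); last exact: frugal_ret.
apply: frugal_bind => [|e].
  apply: frugal_tabulate => i; apply: frugal_bind => *.
    exact: frugal_marg.
  exact: frugal_disc.
by apply: frugal_foldM; first exact: size_enum_ord.
Qed.

Lemma frugal_scaling_step eta rl mu (d : 'I_k -> vec) t :
  frugal eta step_cost (scaling_step k_gt0 rl eta mu d t).
Proof.
rewrite /step_cost; apply: frugal_bind => [|i]; first exact: frugal_select.
apply: frugal_bind => [|m]; first exact: frugal_marg.
apply: frugal_bind => [|q]; first exact: frugal_zipM.
exact/frugal_map/frugal_zipM.
Qed.

Lemma frugal_rounding_step eta mu (d : 'I_k -> vec) i :
  frugal eta (n * (k * (n * 4) + 5) + (n + (1 + (n + n))))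
    (rounding_step eta mu d i).
Proof.
apply: frugal_bind => [|m]; first exact: frugal_marg.
apply: frugal_bind => [|q]; first exact: frugal_zipM.
apply: frugal_bind => [|one]; first exact: frugal_numeral.
apply: frugal_bind => [|q1]; first exact: frugal_zipM.
exact/frugal_map/frugal_zipM.
Qed.

Lemma frugal_sinkhorn T rl (eps : R) (mu : 'I_k -> vec) :
  frugal ((2 * k)%:R * ln n%:R / eps)
    (6 + (T * step_cost + (k * (n * (k * (n * 4) + 5) + (n + (1 + (n + n))))
     + (k * (n * (k * (n * 4) + 5) + n) + (n * 1 + (n.+1 + (k.-1.+1 + n)))))))
    (sinkhorn k_gt0 T rl eps mu).
Proof.
rewrite /sinkhorn.
apply: frugal_numeral_bind; apply: frugal_numeral_bind; apply: frugal_un_bind.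
do 2 apply: frugal_bin_bind.
apply: frugal_numeral_bind; rewrite /eval1 /eval2.
apply: frugal_bind.
  apply: frugal_foldM; first exact: size_iota.
  by move=> *; apply: frugal_scaling_step.
move=> d1; apply: frugal_bind => [|d2].
  apply: frugal_foldM; first exact: size_enum_ord.
  by move=> *; apply: frugal_rounding_step.
apply: frugal_bind => [|v].
  apply: frugal_tabulate => i; apply: frugal_bind => *; first exact: frugal_marg.
  exact: frugal_zipM.
apply: frugal_bind => [|w].
  by apply: frugal_tabulate => i; apply: frugal_un.
apply: frugal_bind => [|s]; first exact: frugal_sumM.
apply: frugal_bind => [|r]; first exact: frugal_powM.
exact/frugal_map/frugal_zipM.
Qed.

Lemma frugal_cost_le eta N (B : R) (A : Type) (m : M A) :
  frugal eta N m -> N%:R <= B -> cost_le eta B (run C m).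
Proof.
move=> [c e] NB; split=> //; apply: le_trans NB; rewrite ler_nat.
  exact: leq_trans (leq_addr _ _) c.
exact: leq_trans (leq_addl _ _) c.
Qed.

End Programs.

(** * The oracle computes marginals *)

Section Marginals.
Variables (R : realType) (n k : nat) (C : tensor R n k).
Implicit Types (d : 'I_k -> 'I_n -> R) (P Q : tensor R n k).

Definition gibbs (eta : R) d : tensor R n k :=
  fun j => (\prod_i d i (j i)) * expR (- eta * C j).

Lemma gibbs_ge0 eta d j : (forall i l, 0 <= d i l) -> 0 <= gibbs eta d j.
Proof. by move=> d0; rewrite mulr_ge0 ?expR_ge0 ?prodr_ge0. Qed.

Lemma marginal_ge0 P i l : (forall j, 0 <= P j) -> 0 <= marginal P i l.
Proof. by move=> P0; apply: sumr_ge0. Qed.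

(** A vanishing weight enters the query as minus infinity and removes exactly
the terms of the sum that contain it. *)
Lemma smin_log_weights (eta : R) d : 0 < eta -> (forall i l, 0 <= d i l) ->
  smin C (fun i l => if 0 < d i l then (ln (d i l) / eta)%:E else -oo%E) eta
  = (- ((eta^-1)%:E * lne (\sum_j gibbs eta d j)%:E))%E.
Proof.
move=> eta0 d0; rewrite /smin; congr (- (_ * lne _))%E.
rewrite -sumEFin; apply: eq_bigr => j _; rewrite /gibbs.
have [/forallP dj|] := boolP [forall i, 0 < d i (j i)].
  rewrite (eq_bigr (fun i => (ln (d i (j i)) / eta)%:E)); last first.
    by move=> i _; rewrite dj.
  rewrite sumEFin -EFinB -EFinM -EFinN /=; congr EFin.
  rewrite mulrBr opprB mulr_sumr expRD expR_sum mulNr; congr (_ * _).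
  apply: eq_bigr => i _; rewrite mulrC divfK ?gt_eqF //.
  by rewrite lnK // posrE.
rewrite negb_forall => /existsP[i di].
have di0 : d i (j i) = 0.
  by apply/eqP; move: (d0 i (j i)) di; rewrite le_eqVlt eq_sym => /orP[->|->].
rewrite (bigD1 i) //= di0 ltxx addNye [in RHS](bigD1 i) //= di0 !mul0r.
by rewrite addey // gt0_muley ?lte_fin.
Qed.

Lemma result_log_weight (eta x : R) :
  ext_of (result C (log_weight n k eta x))
  = if 0 < x then (ln x / eta)%:E else -oo%E.
Proof. by rewrite /result /=; case: ifP. Qed.

(** Zeroing the entries of [d i] other than [l] turns a total mass into an entry
of the marginal; the oracle reports a vanishing mass as infinity. *)
Lemma result_marg (eta : R) d i : 0 < eta -> (forall i l, 0 <= d i l) ->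
  result C (marg eta d i) = marginal (gibbs eta d) i.
Proof.
move=> eta0 d0; rewrite /marg result_tabulate; apply/funext => l.
rewrite result_bind result_tabulate.
pose dl i' l' := if (i' == i) && (l' != l) then 0 else d i' l'.
have dl0 i' l' : 0 <= dl i' l' by rewrite /dl; case: ifP.
rewrite [LHS]/result /=.
rewrite [X in smin C X](_ : _ = fun i' l' =>
  if 0 < dl i' l' then (ln (dl i' l') / eta)%:E else -oo%E); last first.
  apply/funext => i'; rewrite result_tabulate; apply/funext => l'.
  by rewrite /dl; case: ifP => _; [rewrite ltxx | rewrite result_log_weight].
rewrite smin_log_weights //.
have -> : \sum_j gibbs eta dl j = marginal (gibbs eta d) i l.
  rewrite /marginal [RHS]big_mkcond /=; apply: eq_bigr => j _; rewrite /gibbs.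
  case: (eqVneq (j i) l) => [jl|jl].
    congr (_ * _); apply: eq_bigr => i' _; rewrite /dl.
    by case: eqP => [->|//]; rewrite jl eqxx.
  by rewrite (bigD1 i) //= /dl eqxx jl !mul0r.
have : 0 <= marginal (gibbs eta d) i l.
  by apply: marginal_ge0 => j; apply: gibbs_ge0.
rewrite le_eqVlt => /orP[/eqP<-|m0].
  by rewrite /lne lexx gt0_muleNy ?lte_fin ?invr_gt0.
rewrite lne_EFin //= sub0r mulrNN mulrA divff ?gt_eqF // mul1r lnK //.
Qed.

End Marginals.

(** * Relative entropy of unnormalized measures *)

Section RelativeEntropy.
Variables (R : realType) (I : finType).
Implicit Types p q : I -> R.

(** The terms [p i - q i] keep it nonnegative for arguments of any mass; between
marginals this is the criterion of the second greedy rule. *)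
Definition kl q p : R := \sum_i (p i - q i + q i * ln (q i / p i)).

(** In terms of square roots the inequality [ln x <= x - 1] becomes a perfect
square. *)
Lemma le_hellinger_kl (p q : R) : 0 <= p -> 0 <= q -> (0 < q -> 0 < p) ->
  (Num.sqrt p - Num.sqrt q) ^+ 2 <= p - q + q * ln (q / p).
Proof.
move=> p0; rewrite le_eqVlt => /orP[/eqP <- _|q0 /(_ q0) {}p0].
  by rewrite sqrtr0 mul0r addr0 !subr0 sqr_sqrtr.
have sp : 0 < Num.sqrt p by rewrite sqrtr_gt0.
have sq : 0 < Num.sqrt q by rewrite sqrtr_gt0.
have {2 3}-> : p = Num.sqrt p ^+ 2 by rewrite sqr_sqrtr // ltW.
have {2 3 4}-> : q = Num.sqrt q ^+ 2 by rewrite sqr_sqrtr // ltW.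
move: (Num.sqrt p) (Num.sqrt q) sp sq => a b a0 b0.
have -> : ln (b ^+ 2 / a ^+ 2) = - (ln (a / b) * 2).
  rewrite -expr_div_n lnXn ?divr_gt0 // -[b / a]invf_div lnV ?posrE ?divr_gt0 //.
  by rewrite mulNrn mulr_natr.
have : b ^+ 2 * ln (a / b) <= b ^+ 2 * (a / b - 1).
  rewrite ler_pM2l ?exprn_gt0 // -[X in ln X](subrKC 1) le_ln1Dx //.
  by have : 0 < a / b := divr_gt0 a0 b0; lra.
have -> : b ^+ 2 * (a / b - 1) = b * a - b ^+ 2 by field; rewrite gt_eqF.
nra.
Qed.

Lemma kl_ge0 q p : (forall i, 0 <= p i) -> (forall i, 0 <= q i) ->
  (forall i, 0 < q i -> 0 < p i) -> 0 <= kl q p.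
Proof.
move=> p0 q0 qp; apply: sumr_ge0 => i _.
by apply: le_trans (le_hellinger_kl (p0 i) (q0 i) (qp i)); apply: sqr_ge0.
Qed.

(** Pinsker's inequality with a worse constant: [q - p] factors through the
square roots, whose squared distance is at most the divergence. *)
Lemma kl_pinsker q p (e : R) :
  (forall i, 0 <= p i) -> (forall i, 0 <= q i) ->
  (forall i, 0 < q i -> 0 < p i) -> \sum_i p i = 1 -> \sum_i q i = 1 ->
  0 < e -> kl q p <= e ^+ 2 -> \sum_i `|q i - p i| <= 2 * e.
Proof.
move=> p0 q0 qp p1 q1 e0 qpe.
have abs_le i : `|q i - p i| <=
    e^-1 * (p i - q i + q i * ln (q i / p i)) + e / 2 * (p i + q i).
  have := le_hellinger_kl (p0 i) (q0 i) (qp i).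
  set t := _ + q i * _ => ht.
  have {1}-> : q i = Num.sqrt (q i) ^+ 2 by rewrite sqr_sqrtr.
  have {1}-> : p i = Num.sqrt (p i) ^+ 2 by rewrite sqr_sqrtr.
  have pq : p i + q i = Num.sqrt (p i) ^+ 2 + Num.sqrt (q i) ^+ 2.
    by rewrite !sqr_sqrtr.
  rewrite pq; move: ht (sqrtr_ge0 (p i)) (sqrtr_ge0 (q i)).
  move: (Num.sqrt (p i) : R) (Num.sqrt (q i) : R) => a b ht a0 b0.
  (* the arithmetic-geometric mean inequality for [|a - b|] and [a + b] *)
  apply: (@le_trans _ _ (e^-1 * (a - b) ^+ 2 + e / 4 * (a + b) ^+ 2)).
    rewrite subr_sqr normrM (ger0_norm (addr_ge0 b0 a0)).
    set x : R := `|b - a|.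
    have -> : (a - b) ^+ 2 = x ^+ 2 by rewrite real_normK ?num_real // -sqrrN opprB.
    rewrite -subr_ge0 (_ : _ - _ = e^-1 * (x - e / 2 * (a + b)) ^+ 2).
      by rewrite mulr_ge0 ?sqr_ge0 // invr_ge0 ltW.
    by field; rewrite gt_eqF.
  apply: lerD; first by rewrite ler_pM2l ?invr_gt0.
  have : 0 <= e * (a - b) ^+ 2 by rewrite mulr_ge0 ?sqr_ge0 ?ltW.
  nra.
apply: le_trans (ler_sum _ (fun i _ => abs_le i)) _.
rewrite big_split /= -!mulr_sumr -/(kl q p) big_split /= p1 q1.
have : e^-1 * kl q p <= e by rewrite mulrC ler_pdivrMr // -expr2.
lra.
Qed.

(** Jensen's inequality, obtained by comparing with the uniform distribution. *)
Lemma entropy_le q : (forall i, 0 <= q i) -> \sum_i q i = 1 ->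
  - \sum_i q i * ln (q i) <= ln #|I|%:R.
Proof.
move=> q0 q1.
have I0 : (0 < #|I|)%N.
  rewrite lt0n; apply: contra_eq_neq q1 => /card0_eq I0.
  by rewrite big1 ?[0 == 1]eq_sym ?oner_neq0 // => i; have := I0 i.
have c0 : 0 < #|I|%:R :> R by rewrite ltr0n.
have := @kl_ge0 q (fun=> #|I|%:R^-1) (fun=> ltac:(by rewrite invr_ge0 ltW)) q0
  (fun _ _ => ltac:(by rewrite invr_gt0)).
rewrite /kl (eq_bigr (fun i => (#|I|%:R^-1 - q i) + (q i * ln (q i) + q i * ln #|I|%:R))).
  rewrite !big_split /= -mulr_suml sumr_const q1 sumrN q1.
  by rewrite -[_^-1 *+ _]mulr_natl divff ?gt_eqF // subrr add0r mul1r; lra.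
move=> i _; congr (_ + _); rewrite invrK -mulrDr.
have := q0 i; rewrite le_eqVlt => /orP[/eqP <-|qi]; first by rewrite !mul0r.
by rewrite lnM // posrE.
Qed.

End RelativeEntropy.

(** * Couplings and product tensors *)

Section Tensors.
Variables (R : realType) (n k : nat).
Implicit Types (P Q : tensor R n k) (v mu : 'I_k -> 'I_n -> R).

Lemma sum_marginal P i (f : 'I_n -> R) :
  \sum_l f l * marginal P i l
  = \sum_(j : {ffun 'I_k -> 'I_n}) f (j i) * P j.
Proof.
rewrite [RHS](partition_big (fun j : {ffun 'I_k -> 'I_n} => j i) xpredT) //=.
apply: eq_bigr => l _; rewrite /marginal mulr_sumr.
by apply: eq_bigr => j /eqP ->.
Qed.

Lemma total_marginal P i : \sum_l marginal P i l = \sum_j P j.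
Proof.
have := sum_marginal P i (fun=> 1).
by under eq_bigr do rewrite mul1r; under [RHS]eq_bigr do rewrite mul1r.
Qed.

Lemma le_l1_marginal P Q i :
  \sum_l `|marginal P i l - marginal Q i l| <= \sum_j `|P j - Q j|.
Proof.
rewrite -(total_marginal (fun j => `|P j - Q j|) i).
apply: ler_sum => l _; rewrite /marginal -sumrB.
exact: ler_norm_sum.
Qed.

Lemma total_prod v : \sum_(j : {ffun 'I_k -> 'I_n}) \prod_i v i (j i)
  = \prod_i \sum_l v i l.
Proof. by rewrite bigA_distr_bigA. Qed.

(** The entry [l] of a marginal is the total mass after zeroing the other
entries of [v i], and the total mass of a product tensor is a product. *)
Lemma marginal_prod v i l : marginal (fun j => \prod_i' v i' (j i')) i l
  = v i l * \prod_(i' | i' != i) \sum_l' v i' l'.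
Proof.
pose w i' l' := if (i' == i) && (l' != l) then 0 else v i' l'.
transitivity (\prod_i' \sum_l' w i' l').
  rewrite -total_prod /marginal big_mkcond /=; apply: eq_bigr => j _.
  case: (eqVneq (j i) l) => [jl|jl].
    apply: eq_bigr => i' _; rewrite /w; case: eqP => [->|//].
    by rewrite jl eqxx.
  by rewrite (bigD1 i) //= /w eqxx jl mul0r.
rewrite (bigD1 i) //=; congr (_ * _).
  rewrite (bigD1 l) //= big1 => [|l' ll']; first by rewrite /w !eqxx addr0.
  by rewrite /w eqxx ll'.
by apply: eq_bigr => i' /negPf ii'; apply: eq_bigr => l' _; rewrite /w ii'.
Qed.

Lemma coupling_total mu Q (i : 'I_k) : couplings mu Q ->
  (forall i, in_simplex (mu i)) -> \sum_j Q j = 1.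
Proof.
move=> [_ Qmu] /(_ i)[_ <-]; rewrite -(total_marginal Q i).
by apply: eq_bigr => l _; rewrite Qmu.
Qed.

Lemma coupling_le mu Q i j : couplings mu Q -> Q j <= mu i (j i).
Proof.
move=> [Q0 Qmu]; rewrite -Qmu /marginal (bigD1 j) //= lerDl.
exact: sumr_ge0.
Qed.

Lemma le_cmax (C : tensor R n k) j : `|C j| <= cmax C.
Proof. by rewrite /cmax; apply: le_bigmax. Qed.

Lemma simplex_support (x : 'I_n -> R) : in_simplex x -> exists l, 0 < x l.
Proof.
move=> [x0 x1]; apply: contrapT => /forallNP npos; move: x1.
rewrite big1 => [/esym/eqP|l _]; first by rewrite oner_eq0.
by apply/eqP; rewrite eq_le x0 andbT leNgt; apply/negP.
Qed.

Lemma simplex_dim_gt0 (x : 'I_n -> R) : in_simplex x -> (0 < n)%N.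
Proof. by move=> /simplex_support[l _]; apply: leq_ltn_trans (ltn_ord l). Qed.

Lemma cmax_ge0 (C : tensor R n k) : 0 <= cmax C.
Proof. by rewrite /cmax; elim/big_ind: _ => // x y x0 y0; rewrite le_max x0. Qed.

End Tensors.

(** * The potential *)

Section Potential.
Variables (R : realType) (n k : nat) (C : tensor R n k) (eta : R).
Variable mu : 'I_k -> 'I_n -> R.
Hypothesis mu_simplex : forall i, in_simplex (mu i).
Implicit Types (d : 'I_k -> 'I_n -> R) (Q : tensor R n k).
Local Notation G := (gibbs C eta).

Lemma mu_ge0 i l : 0 <= mu i l. Proof. by have [] := mu_simplex i. Qed.

(** Scaling vectors may vanish only where the prescribed marginals do, and there
every coupling vanishes. *)
Definition supported d :=
  (forall i l, 0 <= d i l) /\ (forall i l, 0 < mu i l -> 0 < d i l).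

Lemma supported1 : supported (fun _ _ => 1). Proof. by split. Qed.

Lemma gibbs_gt0 d (j : {ffun 'I_k -> 'I_n}) : supported d -> (forall i, 0 < mu i (j i)) -> 0 < G d j.
Proof.
by move=> [_ dP] mj; rewrite mulr_gt0 ?expR_gt0 // prodr_gt0 // => i _; apply: dP.
Qed.

Lemma supported_ge0 d j : supported d -> 0 <= G d j.
Proof. by case=> d0 _; apply: gibbs_ge0. Qed.

Lemma marginal_gibbs_ge0 d i l : supported d -> 0 <= marginal (G d) i l.
Proof. by move=> dP; apply: marginal_ge0 => j; apply: supported_ge0. Qed.

Lemma coupling_gibbs_gt0 d Q j : couplings mu Q -> supported d ->
  0 < Q j -> 0 < G d j.
Proof.
move=> Qmu dP Qj; apply: gibbs_gt0 => // i.
exact: lt_le_trans Qj (coupling_le _ _ Qmu).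
Qed.

(** This excludes division by zero in a scaling step, except where the
prescribed marginal vanishes too. *)
Lemma marginal_gibbs_gt0 d i l : supported d -> 0 < mu i l ->
  0 < marginal (G d) i l.
Proof.
move=> dP mil.
have /fin_all_exists [f fP] i' := simplex_support (mu_simplex i').
pose j : {ffun 'I_k -> 'I_n} := [ffun i' => if i' == i then l else f i'].
rewrite /marginal (bigD1 j) /=; last by rewrite ffunE eqxx.
apply: ltr_pwDl; last by apply: sumr_ge0 => *; apply: supported_ge0.
by apply: gibbs_gt0 => // i'; rewrite ffunE; case: eqP => [->|].
Qed.

(** Every coupling gives the same total weight to the scaling vectors, so the
potentials of two couplings differ by a constant. *)
Lemma kl_gibbs (i0 : 'I_k) d Q : couplings mu Q -> supported d ->
  kl Q (G d) = \sum_j G d j - 1 + \sum_j Q j * ln (Q j) + eta * inner C Q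
               - \sum_i \sum_l mu i l * ln (d i l).
Proof.
move=> Qmu dP; have [Q0 Qm] := Qmu.
have -> : \sum_i \sum_l mu i l * ln (d i l)
    = \sum_(j : {ffun 'I_k -> 'I_n}) \sum_i ln (d i (j i)) * Q j.
  rewrite [RHS]exchange_big /=; apply: eq_bigr => i _.
  rewrite -(sum_marginal Q i (fun l => ln (d i l))).
  by apply: eq_bigr => l _; rewrite Qm mulrC.
rewrite -(coupling_total i0 Qmu mu_simplex) /inner mulr_sumr.
rewrite -sumrB -!big_split /= -sumrB; apply: eq_bigr => j _.
rewrite -mulr_suml -!addrA; congr (_ + (_ + _)).
have := Q0 j; rewrite le_eqVlt => /orP[/eqP <-|Qj]; first by rewrite !(mul0r, mulr0) subrr addr0.
have gj := coupling_gibbs_gt0 Qmu dP Qj.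
rewrite ln_div ?posrE // mulrBr; congr (_ + _).
have dj i : 0 < d i (j i).
  by apply: dP.2; apply: lt_le_trans Qj (coupling_le _ _ Qmu).
have -> : G d j = expR (\sum_i ln (d i (j i)) + - eta * C j).
  rewrite expRD expR_sum; congr (_ * _).
  by apply: eq_bigr => i _; rewrite lnK // posrE.
by rewrite expRK; ring.
Qed.

Definition scale d i :=
  update d i (fun l => d i l * (mu i l / marginal (G d) i l)).

Lemma gibbs_update d i (c : 'I_n -> R) j :
  G (update d i (fun l => d i l * c l)) j = c (j i) * G d j.
Proof.
rewrite /gibbs mulrA; congr (_ * _).
rewrite (bigD1 i) //= [in RHS](bigD1 i) //= /update eqxx mulrA.
rewrite [c _ * _]mulrC; congr (_ * _).
by apply: eq_bigr => i' /negPf ->.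
Qed.

Lemma marginal_update d i (c : 'I_n -> R) l :
  marginal (G (update d i (fun l => d i l * c l))) i l
  = c l * marginal (G d) i l.
Proof.
by rewrite /marginal mulr_sumr; apply: eq_bigr => j /eqP <-; apply: gibbs_update.
Qed.

Lemma supported_scale d i : supported d -> supported (scale d i).
Proof.
move=> dP; have [d0 d1] := dP; rewrite /scale /update; split=> i' l.
  case: eqP => // _.
  by rewrite mulr_ge0 ?divr_ge0 ?mu_ge0 ?marginal_gibbs_ge0.
case: eqP => [->|_] m0; last exact: d1.
by rewrite mulr_gt0 ?d1 // divr_gt0 // marginal_gibbs_gt0.
Qed.

Lemma marginal_scale d i l : supported d -> marginal (G (scale d i)) i l = mu i l.
Proof.
move=> dP; rewrite marginal_update.
have := mu_ge0 i l; rewrite le_eqVlt => /orP[/eqP <-|m0]; first by rewrite !mul0r.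
by rewrite divfK // gt_eqF // marginal_gibbs_gt0.
Qed.

Lemma total_scale d i : supported d -> \sum_j G (scale d i) j = 1.
Proof.
move=> dP; have [_ <-] := mu_simplex i; rewrite -(total_marginal _ i).
by apply: eq_bigr => l _; rewrite marginal_scale.
Qed.

(** Scaling is the projection in relative entropy onto the tensors whose
[i]-th marginal is [mu i]; this is the Pythagorean identity. *)
Lemma kl_scale d Q i : couplings mu Q -> supported d ->
  kl Q (G (scale d i)) = kl Q (G d) - kl (mu i) (marginal (G d) i).
Proof.
move=> Qmu dP; rewrite !(kl_gibbs i Qmu) //; last exact: supported_scale.
rewrite total_scale // (bigD1 i) //= [in RHS](bigD1 i) //=.
have -> : \sum_l mu i l * ln (scale d i i l)
    = \sum_l mu i l * ln (d i l)
      + \sum_l mu i l * ln (mu i l / marginal (G d) i l).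
  rewrite -big_split; apply: eq_bigr => l _ /=.
  have := mu_ge0 i l; rewrite le_eqVlt => /orP[/eqP <-|m0].
    by rewrite !mul0r addr0.
  rewrite /scale /update eqxx lnM ?mulrDr // posrE ?dP.2 //.
  by rewrite divr_gt0 // marginal_gibbs_gt0.
have -> : \sum_(i' < k | i' != i) \sum_l mu i' l * ln (scale d i i' l)
    = \sum_(i' < k | i' != i) \sum_l mu i' l * ln (d i' l).
  by apply: eq_bigr => i' /negPf ii'; rewrite /scale /update ii'.
rewrite /kl big_split /= sumrB total_marginal (mu_simplex i).2; ring.
Qed.

Lemma kl_marginal_ge0 d i : supported d -> 0 <= kl (mu i) (marginal (G d) i).
Proof.
move=> dP; apply: kl_ge0 => l; [exact: marginal_gibbs_ge0|exact: mu_ge0|].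
exact: marginal_gibbs_gt0.
Qed.

Lemma l1_scale d i : supported d ->
  \sum_j `|G (scale d i) j - G d j| = \sum_l `|mu i l - marginal (G d) i l|.
Proof.
move=> dP; under eq_bigr => j _.
  rewrite gibbs_update -[X in _ - X]mul1r -mulrBl normrM.
  rewrite (ger0_norm (supported_ge0 j dP)); over.
rewrite -(sum_marginal (G d) i (fun l => `|mu i l / marginal (G d) i l - 1|)).
apply: eq_bigr => l _.
have /ger0_norm {2}<- := marginal_gibbs_ge0 i l dP.
rewrite -normrM mulrBl mul1r.
have := mu_ge0 i l; rewrite le_eqVlt => /orP[/eqP <-|m0]; first by rewrite !mul0r.
by rewrite divfK // gt_eqF // marginal_gibbs_gt0.
Qed.

End Potential.

(** * Scaled tensors are bounded below *)

Section Balance.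
Variables (R : realType) (n k : nat) (C : tensor R n k) (eta : R).
Variable mu : 'I_k -> 'I_n -> R.
Hypothesis eta_ge0 : 0 <= eta.
Hypothesis mu_simplex : forall i, in_simplex (mu i).
Implicit Types (d : 'I_k -> 'I_n -> R).
Local Notation G := (gibbs C eta).
Local Notation B := (eta * cmax C).

Lemma gibbs_bounds d (j : {ffun 'I_k -> 'I_n}) : (forall i l, 0 <= d i l) ->
  expR (- B) * \prod_i d i (j i) <= G d j <= expR B * \prod_i d i (j i).
Proof.
move=> d0; have p0 : 0 <= \prod_i d i (j i) by rewrite prodr_ge0.
have := le_cmax C j; rewrite ler_norml => /andP[lC uC].
rewrite /gibbs [_ * expR _]mulrC !ler_wpM2r // !ler_expR mulNr ?lerN2.
  by rewrite -mulrN ler_wpM2l // lerNl.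
by rewrite ler_wpM2l.
Qed.

Lemma marginal_gibbs_bounds d i l : (forall i l, 0 <= d i l) ->
  expR (- B) * (d i l * \prod_(i' | i' != i) \sum_l' d i' l')
  <= marginal (G d) i l
  <= expR B * (d i l * \prod_(i' | i' != i) \sum_l' d i' l').
Proof.
move=> d0; rewrite -marginal_prod /marginal !mulr_sumr.
by apply/andP; split; apply: ler_sum => j _; case/andP: (gibbs_bounds j d0).
Qed.

(** A scaling vector that was never updated is constant; one that was updated
is, up to a factor close to a constant, the prescribed marginal. The profile
[w] covers both cases without asking which indices were ever selected. *)
Definition balanced d := forall i, exists (w : 'I_n -> R) (c : R),
  [/\ 0 < c, forall l, mu i l <= w l <= 1
    & forall l, c * w l <= d i l <= c * w l * expR (2 * B)].

Let B_ge0 : 0 <= B.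
Proof. by rewrite mulr_ge0 ?cmax_ge0. Qed.

Lemma mu_le1 i l : mu i l <= 1.
Proof.
have [m0 <-] := mu_simplex i; rewrite (bigD1 l) //= lerDl.
exact: sumr_ge0.
Qed.

Lemma balanced1 : balanced (fun _ _ => 1).
Proof.
move=> i; exists (fun=> 1), 1; split=> // l; first by rewrite mu_le1 lexx.
by rewrite mulr1 lexx mul1r -expR0 ler_expR mulr_ge0.
Qed.

(** The denominator of the new scaling vector at [l] is a sum over the other
indices in which [l] only enters through the cost. *)
Lemma balanced_scale d i : supported mu d -> balanced d ->
  balanced (scale C eta mu d i).
Proof.
move=> dP dB i'; rewrite /scale /update; case: (eqVneq i' i) => [->|_]; last exact: dB.
have [d0 d1] := dP.
have s0 i2 : 0 < \sum_l d i2 l.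
  have [l /d1 dl] := simplex_support (mu_simplex i2).
  by rewrite (bigD1 l) //= ltr_pwDl // sumr_ge0.
pose rho := \prod_(i2 | i2 != i) \sum_l d i2 l.
have rho0 : 0 < rho by apply: prodr_gt0.
exists (mu i), (expR (- B) / rho); split=> [|l|l].
- by rewrite divr_gt0 ?expR_gt0.
- by rewrite mu_le1 lexx.
have := mu_ge0 mu_simplex i l; rewrite le_eqVlt => /orP[/eqP <-|m0].
  by rewrite !(mul0r, mulr0) lexx.
have dil := d1 _ _ m0.
have mm := marginal_gibbs_gt0 C eta mu_simplex dP m0.
have := marginal_gibbs_bounds i l d0; rewrite -/rho => /andP[lo hi].
move: (marginal _ _ _) mm lo hi => m m1 lo hi.
have eN : expR (- B) * expR B = 1 by rewrite -expRD addNr expR0.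
have le1 : expR (- B) * m <= d i l * rho.
  apply: le_trans (ler_wpM2l (expR_ge0 _) hi) _.
  by rewrite (mulrA (expR (- B))) eN mul1r.
have le2 : d i l * rho <= expR B * m.
  apply: le_trans (ler_wpM2l (expR_ge0 B) lo).
  by rewrite (mulrA (expR B)) (mulrC (expR B)) eN mul1r.
have mr0 : 0 <= mu i l / rho by rewrite divr_ge0 // ltW.
rewrite mulrA; apply/andP; split.
  rewrite ler_pdivlMr //.
  rewrite (_ : _ * m = mu i l / rho * (expR (- B) * m)); last by ring.
  apply: le_trans (ler_wpM2l mr0 le1) _.
  by rewrite mulrCA mulfVK ?gt_eqF.
rewrite ler_pdivrMr //.
have -> : expR (2 * B) = expR B * expR B by rewrite -expRD mulr_natl.
rewrite (_ : _ * m = expR (- B) * expR B * (mu i l / rho * (expR B * m))); last by ring.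
rewrite eN mul1r; apply: le_trans (ler_wpM2l mr0 le2).
by rewrite mulrCA mulfVK ?gt_eqF.
Qed.

(** Lower bounds on the scaling vectors up to constants [c i] become absolute
because the total mass, which is at most the product of the [c i] up to known
factors, equals [1]. *)
Lemma balanced_lower_bound d : (forall i l, 0 <= d i l) -> balanced d ->
  \sum_j G d j = 1 ->
  exists w : 'I_k -> 'I_n -> R, (forall i l, mu i l <= w i l <= 1) /\
    forall j : {ffun 'I_k -> 'I_n}, \prod_i w i (j i)
      <= n%:R ^+ k * expR ((2 * k + 2)%:R * B) * G d j.
Proof.
move=> d0 /fin_all_exists [w /fin_all_exists [c H]] G1; exists w.
have w1 i l : mu i l <= w i l <= 1 by have [_ + _] := H i.
split=> // j.
have w0 i l : 0 <= w i l.
  by case/andP: (w1 i l) => + _; apply: le_trans; apply: mu_ge0.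
have c0 i : 0 < c i by have [] := H i.
pose cc := \prod_i c i.
have low : expR (- B) * (cc * \prod_i w i (j i)) <= G d j.
  have /andP[+ _] := gibbs_bounds j d0; apply: le_trans.
  rewrite ler_pM2l ?expR_gt0 // /cc -big_split /=.
  apply: ler_prod => i _; rewrite mulr_ge0 ?(ltW (c0 i)) //=.
  by have [_ _ /(_ (j i))/andP[]] := H i.
have high : 1 <= expR B * (cc * (expR (2 * B) ^+ k * n%:R ^+ k)).
  apply: (@le_trans _ _ (expR B * \prod_i \sum_l d i l)).
    rewrite -[X in X <= _]G1.
    rewrite -total_prod mulr_sumr; apply: ler_sum => j' _.
    by case/andP: (gibbs_bounds j' d0).
  rewrite ler_pM2l ?expR_gt0 // -exprMn /cc.
  have -> : (expR (2 * B) * n%:R) ^+ k = \prod_(i < k) (expR (2 * B) * n%:R).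
    by rewrite prodr_const card_ord.
  rewrite -big_split /=.
  apply: ler_prod => i _; rewrite sumr_ge0 //=.
  have -> : c i * (expR (2 * B) * n%:R) = \sum_(l < n) c i * expR (2 * B).
    by rewrite sumr_const card_ord mulrA mulr_natr.
  apply: ler_sum => l _; have [_ _ /(_ l)/andP[_ du]] := H i.
  apply: le_trans du _; rewrite ler_pM2r ?expR_gt0 //.
  by rewrite ler_piMr ?(ltW (c0 i)) //; case/andP: (w1 i l).
have wp0 : 0 <= \prod_i w i (j i) by apply: prodr_ge0.
apply: le_trans (ler_peMl wp0 high) _.
have -> : expR ((2 * k + 2)%:R * B) = expR (2 * B) ^+ k * (expR B * expR B).
  rewrite -expRM_natl -!expRD; congr expR; rewrite natrD natrM; ring.
apply: le_trans (_ : n%:R ^+ k * (expR (2 * B) ^+ k * (expR B * expR B))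
  * (expR (- B) * (cc * \prod_i w i (j i))) <= _); last first.
  by rewrite ler_wpM2l // !mulr_ge0 ?exprn_ge0 ?expR_ge0 ?ler0n.
rewrite expRN le_eqVlt; apply/orP; left; apply/eqP.
by field; rewrite gt_eqF // expR_gt0.
Qed.

End Balance.

(** * Rounding to a coupling *)

Section Rounding.
Variables (R : realType) (n k : nat) (C : tensor R n k) (eta : R).
Variable mu : 'I_k -> 'I_n -> R.
Hypothesis mu_simplex : forall i, in_simplex (mu i).
Implicit Types (d : 'I_k -> 'I_n -> R) (s : seq 'I_k).
Local Notation G := (gibbs C eta).

Definition cut d i l := Num.min 1 (mu i l / marginal (G d) i l).

Definition truncate d i := update d i (fun l => d i l * cut d i l).

Definition marginal_error d i : R := \sum_l `|mu i l - marginal (G d) i l|.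

Let cutP d i l : (forall i l, 0 <= d i l) ->
  [/\ 0 <= cut d i l, cut d i l <= 1,
      cut d i l * marginal (G d) i l <= mu i l
    & (1 - cut d i l) * marginal (G d) i l
      <= Num.max 0 (marginal (G d) i l - mu i l)].
Proof.
move=> d0; rewrite /cut.
have : 0 <= marginal (G d) i l by apply: marginal_ge0 => j; apply: gibbs_ge0.
have : 0 <= mu i l by apply: mu_ge0.
move: (mu i l) (marginal _ _ _) => x y x0 y0.
have q0 : 0 <= x / y by rewrite divr_ge0.
split; rewrite ?le_min ?ler01 ?ge_min ?lexx //.
- have := y0; rewrite le_eqVlt => /orP[/eqP <-|y1]; first by rewrite mulr0.
  by rewrite -ler_pdivlMr // ge_min lexx orbT.
rewrite le_max minEle; case: ifP => [_|_]; first by rewrite subrr mul0r lexx.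
have := y0; rewrite le_eqVlt => /orP[/eqP <-|y1]; first by rewrite mulr0 lexx.
by rewrite mulrBl mul1r divfK ?gt_eqF // lexx orbT.
Qed.

Lemma truncate_ge0 d i : (forall i l, 0 <= d i l) ->
  forall i' l, 0 <= truncate d i i' l.
Proof.
move=> d0 i' l; rewrite /truncate /update; case: eqP => // _.
by have [h _ _ _] := cutP i l d0; rewrite mulr_ge0.
Qed.

(** Truncating one index only decreases the tensor, so it never spoils the
bounds obtained for the others, and the mass it removes is at most the excess
that the index had at the beginning. *)
Lemma truncate_all d s : (forall i l, 0 <= d i l) ->
  let d' := foldl truncate d s in
  [/\ forall i l, 0 <= d' i l,
      forall j, G d' j <= G d j,
      forall i l, i \in s -> marginal (G d') i l <= mu i l
    & \sum_j (G d j - G d' j)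
      <= \sum_(i <- s) \sum_l Num.max 0 (marginal (G d) i l - mu i l)].
Proof.
elim: s d => [|i s IH] d d0 /=.
  by split=> //; rewrite big_nil big1 // => j _; rewrite subrr.
have d1 := truncate_ge0 i d0.
have [h1 h2 h3 h4] := IH _ d1.
have le1 j : G (truncate d i) j <= G d j.
  rewrite gibbs_update -[leRHS]mul1r ler_wpM2r ?gibbs_ge0 //.
  by have [] := cutP i (j i) d0.
split=> // [j|i' l|]; first exact: le_trans (h2 j) (le1 j).
  rewrite inE => /orP[/eqP ->|]; last exact: h3.
  have [_ _ + _] := cutP i l d0; apply: le_trans.
  rewrite -(marginal_update C eta d i (cut d i)).
  by apply: ler_sum => j _; apply: h2.
rewrite big_cons.
rewrite (eq_bigr (fun j => (G d j - G (truncate d i) j) +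
  (G (truncate d i) j - G (foldl truncate (truncate d i) s) j))); last first.
  by move=> j _; rewrite addrA subrK.
rewrite big_split /=; apply: lerD.
  rewrite (eq_bigr (fun j : {ffun 'I_k -> 'I_n} => (1 - cut d i (j i)) * G d j)).
    rewrite -(sum_marginal (G d) i (fun l => 1 - cut d i l)).
    by apply: ler_sum => l _; have [] := cutP i l d0.
  by move=> j _; rewrite gibbs_update mulrBl mul1r.
apply: le_trans h4 _; apply: ler_sum => i' _; apply: ler_sum => l _.
rewrite ge_max le_max lexx /= le_max lerD2r orbC.
by rewrite /marginal (ler_sum _ (fun j _ => le1 j)).
Qed.

Variable k_gt0 : (0 < k)%N.
Local Notation i0 := (Ordinal k_gt0).

Definition truncated d := foldl truncate d (enum 'I_k).

Definition residual d i l := mu i l - marginal (G d) i l.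

Definition correction d :=
  update (residual d) i0
    (fun l => residual d i0 l / (\sum_j `|residual d i0 j|) ^+ k.-1).

Definition rounded d :=
  represented C eta (truncated d) (correction (truncated d)).

Definition deficit d : R := 1 - \sum_j G (truncated d) j.

Lemma truncated_ge0 d i l : (forall i l, 0 <= d i l) -> 0 <= truncated d i l.
Proof. by move=> d0; have [h _ _ _] := truncate_all (enum 'I_k) d0; apply: h. Qed.

Lemma truncated_le d j : (forall i l, 0 <= d i l) -> G (truncated d) j <= G d j.
Proof. by move=> d0; have [_ h _ _] := truncate_all (enum 'I_k) d0; apply: h. Qed.

Lemma residual_ge0 d i l : (forall i l, 0 <= d i l) ->
  0 <= residual (truncated d) i l.
Proof.
move=> d0; have [_ _ + _] := truncate_all (enum 'I_k) d0.
by move=> /(_ i l); rewrite mem_enum subr_ge0; apply.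
Qed.

Lemma residual_le d i l : (forall i l, 0 <= d i l) ->
  residual (truncated d) i l <= mu i l.
Proof.
move=> d0; rewrite gerBl; apply: marginal_ge0 => j.
by apply: gibbs_ge0 => i' l'; apply: truncated_ge0.
Qed.

Lemma total_residual d i : \sum_l residual (truncated d) i l = deficit d.
Proof. by rewrite sumrB (mu_simplex i).2 total_marginal. Qed.

Lemma deficit_ge0 d : (forall i l, 0 <= d i l) -> 0 <= deficit d.
Proof.
by move=> d0; rewrite -(total_residual d i0) sumr_ge0 // => l _; apply: residual_ge0.
Qed.

Lemma deficit_le1 d : (forall i l, 0 <= d i l) -> deficit d <= 1.
Proof.
move=> d0; rewrite gerBl sumr_ge0 // => j _; apply: gibbs_ge0 => *.
exact: truncated_ge0.
Qed.

Lemma deficit_le d : (forall i l, 0 <= d i l) -> \sum_j G d j = 1 ->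
  deficit d <= \sum_i marginal_error d i.
Proof.
move=> d0 G1; rewrite /deficit -G1 -sumrB.
have [_ _ _ h] := truncate_all (enum 'I_k) d0; apply: le_trans h _.
rewrite big_enum; apply: ler_sum => i _; apply: ler_sum => l _.
by rewrite ge_max normr_ge0 distrC ler_norm.
Qed.

Lemma correctionE d (j : {ffun 'I_k -> 'I_n}) : (forall i l, 0 <= d i l) ->
  \prod_i correction (truncated d) i (j i)
  = (deficit d ^+ k.-1)^-1 * \prod_i residual (truncated d) i (j i).
Proof.
move=> d0; rewrite (bigD1 i0) //= [in RHS](bigD1 i0) //= mulrA.
congr (_ * _); last first.
  by apply: eq_bigr => i /negPf ii0; rewrite /correction /update ii0.
rewrite /correction /update eqxx mulrC; congr (_ * _).
rewrite -(total_residual d i0); congr ((_ ^+ _)^-1); apply: eq_bigr => l _.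
by rewrite ger0_norm // residual_ge0.
Qed.

Lemma rounded_split d j : (forall i l, 0 <= d i l) -> rounded d j
  = G (truncated d) j
    + (deficit d ^+ k.-1)^-1 * \prod_i residual (truncated d) i (j i).
Proof. by move=> d0; rewrite -correctionE. Qed.

Lemma correction_ge0 d i l : (forall i l, 0 <= d i l) ->
  0 <= correction (truncated d) i l.
Proof.
move=> d0; rewrite /correction /update; case: eqP => _; last exact: residual_ge0.
by rewrite divr_ge0 ?residual_ge0 // exprn_ge0 // sumr_ge0.
Qed.

(** All the residuals have the same total mass, which is why one normalization
corrects all the marginals at once. *)
Lemma marginal_correction d i l : (forall i l, 0 <= d i l) ->
  (deficit d ^+ k.-1)^-1
    * marginal (fun j => \prod_i residual (truncated d) i (j i)) i l
  = residual (truncated d) i l.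
Proof.
move=> d0; rewrite marginal_prod.
rewrite (eq_bigr (fun=> deficit d)) => [|i' _]; last by rewrite total_residual.
rewrite prodr_const.
have -> : #|[pred i' | i' != i]| = k.-1.
  by have := cardC1 i; rewrite card_ord => <-; apply: eq_card.
have := deficit_ge0 d0; rewrite le_eqVlt => /orP[/eqP h|h].
  have : residual (truncated d) i l = 0; last by move=> ->; rewrite mul0r mulr0.
  apply: (psumr_eq0P (P := xpredT) (F := residual (truncated d) i)) => //.
    by move=> l' _; apply: residual_ge0.
  by rewrite total_residual.
by rewrite mulrCA mulVf ?mulr1 // gt_eqF // exprn_gt0.
Qed.

Lemma coupling_rounded d : (forall i l, 0 <= d i l) -> couplings mu (rounded d).
Proof.
move=> d0; split=> [j|i l].
  rewrite /rounded /represented addr_ge0 //.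
    by apply: gibbs_ge0 => *; apply: truncated_ge0.
  by rewrite prodr_ge0 // => i _; apply: correction_ge0.
rewrite /marginal; under eq_bigr do rewrite rounded_split //.
rewrite big_split /= -mulr_sumr.
rewrite -/(marginal (G (truncated d)) i l).
rewrite -/(marginal (fun j => \prod_i residual (truncated d) i (j i)) i l).
by rewrite marginal_correction // addrC subrK.
Qed.

Definition rounding_factor : R :=
  2 + k%:R * ln n%:R + (2 * k + 2)%:R * (eta * cmax C) + 2 * k%:R.

Let mul_ln_inv_le (t r : R) : 0 < t -> 0 < r -> t <= r ^+ 2 -> t * ln t^-1 <= 2 * r.
Proof.
move=> t0 r0 tr; have st : 0 < Num.sqrt t by rewrite sqrtr_gt0.
have sr : Num.sqrt t <= r by rewrite -(ger0_norm (ltW r0)) -sqrtr_sqr ler_wsqrtr.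
have tE : t = Num.sqrt t ^+ 2 by rewrite sqr_sqrtr // ltW.
rewrite tE; move: (Num.sqrt t : R) st sr => u u0 ur.
rewrite -exprVn lnXn ?invr_gt0 // mulrnAr -mulr_natl ler_pM2l //.
apply: (@le_trans _ _ (u ^+ 2 * u^-1)); last first.
  by rewrite expr2 mulfK ?gt_eqF.
rewrite ler_pM2l ?exprn_gt0 //; apply/ltW/ln_sublinear; rewrite invr_gt0 //.
Qed.

(** Where the rank-one correction [b] is large compared with the tensor [p] it
is added to, [p] is still at least the product of the marginals up to a
factor; so the ratio costs [ln (b / p)], a polynomial plus [ln (1 / deficit)],
and is paid only by a mass of [deficit]. *)
Lemma kl_rounded d (r : R) : 0 <= eta -> supported mu d -> balanced C eta mu d ->
  \sum_j G d j = 1 -> 0 < r <= 1 -> \sum_i marginal_error d i <= r ^+ 2 ->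
  kl (rounded d) (G d)
  <= r * rounding_factor.
Proof.
rewrite /rounding_factor; move=> eta0 dP dB G1 /andP[r0 r1] errs; have [d0 d1] := dP.
have rc := coupling_rounded d0.
have n0 := simplex_dim_gt0 (mu_simplex i0).
have Gd0 j : 0 <= G d j by apply: gibbs_ge0.
set t := deficit d; have t0 : 0 <= t := deficit_ge0 d0.
have t1 : t <= 1 := deficit_le1 d0.
have tr : t <= r ^+ 2 := le_trans (deficit_le d0 G1) errs.
have kl_sum : kl (rounded d) (G d) = \sum_j rounded d j * ln (rounded d j / G d j).
  by rewrite /kl big_split /= sumrB G1 (coupling_total i0 rc mu_simplex) subrr add0r.
have [w [w1 wG]] := balanced_lower_bound eta0 mu_simplex d0 dB G1.
set K := n%:R ^+ k * expR _ in wG.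
have K1 : 1 <= K.
  have b0 : 0 <= eta * cmax C by rewrite mulr_ge0 ?cmax_ge0.
  rewrite -[1]mulr1 ler_pM // ?exprn_ege1 ?ler1n //.
  by rewrite -expR0 ler_expR mulr_ge0 ?ler0n.
have lnK : ln K = k%:R * ln n%:R + (2 * k + 2)%:R * (eta * cmax C).
  rewrite lnM ?posrE ?exprn_gt0 ?ltr0n ?expR_gt0 // expRK lnXn ?ltr0n //.
  by rewrite (mulr_natl (ln n%:R)).
set kap := k%:R * ln n%:R + _ in lnK.
rewrite -(addrA 2) -/kap; clearbody kap K.
have kap0 : 0 <= kap by rewrite -lnK ln_ge0.
pose b (j : {ffun 'I_k -> 'I_n}) := (t ^+ k.-1)^-1 * \prod_i residual (truncated d) i (j i).
have b0 j : 0 <= b j.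
  rewrite mulr_ge0 ?invr_ge0 ?exprn_ge0 // prodr_ge0 // => i _.
  exact: residual_ge0.
have bt : \sum_j b j = t.
  rewrite -[RHS](total_residual d i0) -(total_marginal b i0).
  by apply: eq_bigr => l _; rewrite -marginal_correction // /marginal -mulr_sumr.
(* without deficit nothing is removed or added *)
have := t0; rewrite le_eqVlt => /orP[/eqP tz|tp].
  have bz j : b j = 0.
    by apply: (psumr_eq0P (P := xpredT) (F := b)) => //; rewrite bt -tz.
  have -> : kl (rounded d) (G d) = 0.
    have QG j : rounded d j <= G d j.
      by rewrite rounded_split // -/(b j) bz addr0 truncated_le.
    have QE j : rounded d j = G d j.
      apply/eqP; rewrite eq_sym -subr_eq0; apply/eqP.
      apply: (psumr_eq0P (P := xpredT) (F := fun j => G d j - rounded d j)) => //.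
        by move=> j' _; rewrite subr_ge0.
      by rewrite sumrB G1 (coupling_total i0 rc mu_simplex) subrr.
    rewrite kl_sum big1 // => j _; rewrite QE.
    have := Gd0 j; rewrite le_eqVlt => /orP[/eqP <-|g0]; first by rewrite mul0r.
    by rewrite divff ?gt_eqF // ln1 mulr0.
  by rewrite mulr_ge0 ?(ltW r0) // !addr_ge0 // mulr_ge0.
(* with [a <= g], the summand [(a + x) * ln ((a + x) / g)] is at most
   [(a + x) * ln (1 + x / g)], and [a * ln (1 + x / g) <= x] *)
have term j : rounded d j * ln (rounded d j / G d j)
    <= b j * (2 + kap + k%:R * ln t^-1).
  rewrite rounded_split // -/t -/(b j).
  have aG := truncated_le j d0.
  have a0 : 0 <= G (truncated d) j.
    by apply: gibbs_ge0 => *; apply: truncated_ge0.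
  have := Gd0 j; rewrite le_eqVlt => /orP[/eqP gz|g0].
    by rewrite -gz invr0 mulr0 ln0 // mulr0 mulr_ge0 // !addr_ge0 // mulr_ge0 // ln_ge0 // invf_ge1.
  have bG : b j / G d j <= K / t ^+ k.-1.
    rewrite ler_pdivrMr // /b mulrC mulrAC ler_wpM2r ?invr_ge0 ?exprn_ge0 //.
    apply: le_trans (wG j); apply: ler_prod => i _.
    rewrite residual_ge0 //=; apply: le_trans (residual_le _ _ d0) _.
    by case/andP: (w1 i (j i)).
  move: (G (truncated d) j) (G d j) (b j) (b0 j) a0 aG g0 bG => a g x x0 a0 ag g0 xg.
  have y0 : 0 <= x / g by rewrite divr_ge0 // ltW.
  have ln_le : ln (1 + x / g) <= 1 + kap + k%:R * ln t^-1.
    apply: (@le_trans _ _ (ln (2 * (K * t^-1 ^+ k)))).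
      have tk : 1 <= t^-1 ^+ k by rewrite exprn_ege1 // invf_ge1.
      have Kt : 1 <= K * t^-1 ^+ k by rewrite -[1]mulr1 ler_pM.
      have Ktp : K / t ^+ k.-1 <= K * t^-1 ^+ k.
        rewrite ler_pM2l ?(lt_le_trans ltr01 K1) // -exprVn.
        by rewrite ler_weXn2l ?invf_ge1 // leq_pred.
      by rewrite ler_ln ?posrE //; lra.
    have K0 : 0 < K := lt_le_trans ltr01 K1.
    have tk0 : 0 < t^-1 ^+ k by rewrite exprn_gt0 // invr_gt0.
    rewrite lnM ?posrE ?mulr_gt0 // lnM ?posrE // lnK lnXn ?invr_gt0 // mulr_natl addrA.
    rewrite !lerD2r; have := @le_ln1Dx R 1; rewrite -natr1 => h.
    by apply: h; lra.
  have l0 : 0 <= ln (1 + x / g) by rewrite ln_ge0 // lerDl.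
  apply: (@le_trans _ _ ((a + x) * ln (1 + x / g))).
    have := addr_ge0 a0 x0; rewrite le_eqVlt => /orP[/eqP <-|ax0].
      by rewrite !mul0r.
    rewrite ler_pM2l // ler_ln ?posrE ?divr_gt0 //; last by lra.
    by rewrite mulrDl lerD2r ler_pdivrMr // mul1r.
  have alnx : a * ln (1 + x / g) <= x.
    apply: le_trans (ler_wpM2r l0 ag) _.
    apply: le_trans (ler_wpM2l (ltW g0) (_ : _ <= x / g)) _.
      by apply: le_ln1Dx; lra.
    by rewrite mulrC divfK // gt_eqF.
  have := ler_wpM2l x0 ln_le; nra.
rewrite kl_sum; apply: le_trans (ler_sum _ (fun j _ => term j)) _.
rewrite -mulr_suml bt.
have tl := mul_ln_inv_le tp r0 tr.
have tr1 : t <= r by apply: le_trans tr _; rewrite expr2 ler_piMr // ltW.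
have -> : t * (2 + kap + k%:R * ln t^-1) = t * (2 + kap) + k%:R * (t * ln t^-1) by ring.
apply: (@le_trans _ _ (r * (2 + kap) + k%:R * (2 * r))).
  by apply: lerD; [rewrite ler_wpM2r // addr_ge0 | rewrite ler_wpM2l].
by rewrite le_eqVlt; apply/orP; left; apply/eqP; ring.
Qed.

End Rounding.

(** * Convergence of the iteration *)

Section Convergence.
Variables (R : realType) (n k : nat) (C : tensor R n k) (eta : R).
Variables (mu : 'I_k -> 'I_n -> R) (k_gt0 : (0 < k)%N).
Hypothesis eta_gt0 : 0 < eta.
Hypothesis mu_simplex : forall i, in_simplex (mu i).
Local Notation G := (gibbs C eta).
Local Notation B := (eta * cmax C).
Local Notation i0 := (Ordinal k_gt0).
Implicit Types (Q : tensor R n k).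

Variables (sel : nat -> 'I_k) (it : nat -> 'I_k -> 'I_n -> R).
Hypothesis it0 : it 0 = fun _ _ => 1.
Hypothesis itS : forall t, it t.+1 = scale C eta mu (it t) (sel t).
Local Notation drop t := (kl (mu (sel t)) (marginal (G (it t)) (sel t))).
Local Notation err t i := (marginal_error C eta mu (it t) i).

Lemma it_supported t : supported mu (it t).
Proof.
elim: t => [|t IH]; first by rewrite it0; apply: supported1.
by rewrite itS; apply: supported_scale.
Qed.

Let it_ge0 t i l : 0 <= it t i l. Proof. by have [] := it_supported t. Qed.

Lemma it_balanced t : balanced C eta mu (it t).
Proof.
elim: t => [|t IH]; first by rewrite it0; apply: balanced1 => //; apply: ltW.
by rewrite itS; apply: balanced_scale => //; [apply: ltW | apply: it_supported].
Qed.

Lemma it_total t : (0 < t)%N -> \sum_j G (it t) j = 1.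
Proof. by case: t => // t _; rewrite itS total_scale //; apply: it_supported. Qed.

Lemma kl_it Q t : couplings mu Q -> kl Q (G (it t.+1)) = kl Q (G (it t)) - drop t.
Proof. by move=> Qmu; rewrite itS kl_scale //; apply: it_supported. Qed.

Lemma drop_ge0 t : 0 <= drop t.
Proof. by apply: kl_marginal_ge0 => //; apply: it_supported. Qed.

Lemma kl_it_le Q s t : couplings mu Q -> (s <= t)%N ->
  kl Q (G (it t)) <= kl Q (G (it s)).
Proof.
move=> Qmu /subnKC <-; elim: (t - s)%N => [|u IH]; first by rewrite addn0.
by rewrite addnS kl_it //; apply: le_trans IH; rewrite gerBl drop_ge0.
Qed.

Lemma kl_it_ge0 Q t : couplings mu Q -> 0 <= kl Q (G (it t)).
Proof.
move=> Qmu; have [Q0 _] := Qmu; have dP := it_supported t.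
apply: kl_ge0 => // j; first exact: (supported_ge0 C eta j dP).
exact: (coupling_gibbs_gt0 C eta Qmu dP).
Qed.

Lemma coupling_entropy Q : couplings mu Q ->
  - (\sum_j Q j * ln (Q j)) <= k%:R * ln n%:R.
Proof.
move=> Qmu; have [Q0 _] := Qmu.
apply: le_trans (entropy_le Q0 (coupling_total i0 Qmu mu_simplex)) _.
rewrite card_ffun !card_ord natrX.
have [->|n0] := posnP n; last by rewrite lnXn ?ltr0n // mulr_natl.
by rewrite expr0n gtn_eqF //= ln0 // mulr0.
Qed.

Lemma coupling_entropy_le0 Q : couplings mu Q -> \sum_j Q j * ln (Q j) <= 0.
Proof.
move=> Qmu; have [Q0 _] := Qmu; apply: sumr_le0 => j _.
rewrite mulr_ge0_le0 // ln_le0 //.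
apply: le_trans (coupling_le i0 j Qmu) _; exact: mu_le1.
Qed.

(** The initial potential can be exponentially large because of the total mass of
the unscaled tensor; a single update brings it down to a polynomial. *)
Lemma kl_first Q : couplings mu Q ->
  kl Q (G (it 1)) <= k.+1%:R * ln n%:R + 2 * B.
Proof.
move=> Qmu; rewrite (kl_gibbs C eta mu_simplex i0 Qmu) //; last exact: it_supported.
rewrite it_total // subrr add0r.
have [Q0 _] := Qmu.
have cost : eta * inner C Q <= B.
  rewrite ler_pM2l // /inner -[leRHS]mulr1 -(coupling_total i0 Qmu mu_simplex).
  rewrite mulr_sumr; apply: ler_sum => j _; rewrite ler_wpM2r //.
  exact: le_trans (ler_norm _) (le_cmax C j).
have n0 := simplex_dim_gt0 (mu_simplex i0).
have m_le i l : marginal (G (it 0)) i l <= expR B * n%:R ^+ k.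
  apply: (@le_trans _ _ (\sum_j G (it 0) j)).
    rewrite -(total_marginal _ i) (bigD1 l) //= lerDl sumr_ge0 // => l' _.
    exact: (marginal_gibbs_ge0 C eta _ _ (it_supported 0)).
  apply: (@le_trans _ _ (expR B * \sum_(j : {ffun 'I_k -> 'I_n}) \prod_i it 0 i (j i))).
    rewrite mulr_sumr; apply: ler_sum => j _.
    by case/andP: (gibbs_bounds C (ltW eta_gt0) j (it_ge0 0)).
  rewrite ler_pM2l ?expR_gt0 // total_prod it0.
  rewrite (eq_bigr (fun=> n%:R)) => [|i' _]; last by rewrite sumr_const card_ord.
  by rewrite prodr_const card_ord.
have scal : - \sum_i \sum_l mu i l * ln (it 1 i l) <= ln n%:R + (B + k%:R * ln n%:R).
  rewrite (bigD1 (sel 0)) //= [X in _ + X]big1 ?addr0 => [|i ne]; last first.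
    rewrite big1 // => l _.
    by rewrite itS it0 /scale /update (negPf ne) ln1 mulr0.
  have [m0 m1] := mu_simplex (sel 0).
  apply: (@le_trans _ _ (- (\sum_l mu (sel 0) l * ln (mu (sel 0) l))
     + \sum_l mu (sel 0) l * (B + k%:R * ln n%:R))); last first.
    rewrite -mulr_suml m1 mul1r lerD2r.
    by apply: le_trans (entropy_le m0 m1) _; rewrite card_ord.
  rewrite -!sumrN -big_split /=; apply: ler_sum => l _.
  have := m0 l; rewrite le_eqVlt => /orP[/eqP <-|ml]; first by rewrite !mul0r oppr0 addr0.
  rewrite itS it0 /scale /update eqxx mul1r.
  have mm := marginal_gibbs_gt0 C eta mu_simplex (it_supported 0) ml.
  rewrite -it0 ln_div ?posrE // mulrBr opprB [leLHS]addrC lerD2l ler_pM2l //.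
  have -> : B + k%:R * ln n%:R = ln (expR B * n%:R ^+ k).
    rewrite lnM ?posrE ?expR_gt0 ?exprn_gt0 ?ltr0n // expRK lnXn ?ltr0n //.
    by rewrite (mulr_natl (ln n%:R)).
  by rewrite ler_ln ?posrE ?mulr_gt0 ?expR_gt0 ?exprn_gt0 ?ltr0n.
have := coupling_entropy_le0 Qmu; rewrite -natr1; lra.
Qed.

Lemma drop_small_error t e : (0 < t)%N -> 0 < e -> drop t <= e ^+ 2 ->
  err t (sel t) <= 2 * e.
Proof.
move=> t0 e0 h; have dP := it_supported t.
apply: kl_pinsker => // [l|l|l||].
- exact: (marginal_gibbs_ge0 C eta _ _ dP).
- exact: mu_ge0.
- exact: marginal_gibbs_gt0.
- by rewrite total_marginal it_total.
- exact: (mu_simplex _).2.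
Qed.

Lemma greedy_small_error D t e : (0 < t)%N -> 0 < e -> drop t <= e ^+ 2 ->
  (forall i, match D with
             | L1 => err t i <= err t (sel t)
             | KL => kl (mu i) (marginal (G (it t)) i) <= drop t
             end) ->
  forall i, err t i <= 2 * e.
Proof.
move=> t0 e0 h; case: D => hD i.
  exact: le_trans (hD i) (drop_small_error t0 e0 h).
have dP := it_supported t.
apply: kl_pinsker => // [l|l|l|||].
- exact: (marginal_gibbs_ge0 C eta _ _ dP).
- exact: mu_ge0.
- exact: marginal_gibbs_gt0.
- by rewrite total_marginal it_total.
- exact: (mu_simplex _).2.
- exact: le_trans (hD i) h.
Qed.

(** Over a stretch of iterations in which the potential hardly moves the tensor
hardly moves either; so if every index is selected in the stretch, every
marginal was already nearly correct at its beginning. *)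
Lemma covering_small_error Q t L e : couplings mu Q -> (0 < t)%N -> 0 < e ->
  kl Q (G (it t)) - kl Q (G (it (t + L))) <= e ^+ 2 ->
  (forall i, exists2 u, (u < L)%N & sel (t + u) = i) ->
  forall i, err t i <= 2 * e * L%:R.
Proof.
move=> Qmu t0 e0 small cover i.
have dropu u : (u < L)%N -> drop (t + u) <= e ^+ 2.
  move=> uL; apply: le_trans small.
  have -> : drop (t + u) = kl Q (G (it (t + u))) - kl Q (G (it (t + u).+1)).
    by rewrite kl_it //; ring.
  rewrite lerB // kl_it_le // ?leq_addr // -addnS leq_add2l //.
have move_le u : (u <= L)%N ->
    \sum_j `|G (it (t + u)) j - G (it t) j| <= 2 * e * u%:R.
  elim: u => [|u IH] uL.
    by rewrite addn0 mulr0 big1 // => j _; rewrite subrr normr0.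
  rewrite -(@natr1 _ u) (mulrDr (2 * e)) mulr1; apply: (@le_trans _ _
    (\sum_j `|G (it (t + u)) j - G (it t) j|
     + \sum_j `|G (it (t + u).+1) j - G (it (t + u)) j|)).
    rewrite addnS -big_split /=; apply: ler_sum => j _.
    by rewrite addrC; apply: ler_distD.
  apply: lerD; first exact: IH (ltnW uL).
  rewrite itS l1_scale //; last exact: it_supported.
  by apply: drop_small_error (dropu u uL) => //; rewrite addn_gt0 t0.
have [u uL su] := cover i.
apply: (@le_trans _ _ (2 * e + 2 * e * u%:R)); last first.
  rewrite -[X in X + _]mulr1 -(mulrDr (2 * e)) nat1r ler_pM2l ?mulr_gt0 //.
  by rewrite ler_nat.
apply: (@le_trans _ _ (err (t + u) i + \sum_j `|G (it (t + u)) j - G (it t) j|)).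
  apply: le_trans (lerD (lexx _) (le_l1_marginal _ _ i)).
  rewrite /marginal_error -big_split /=; apply: ler_sum => l _.
  exact: ler_distD.
apply: lerD; last exact: move_le (ltnW uL).
rewrite -su; apply: drop_small_error (dropu u uL) => //.
by rewrite addn_gt0 t0.
Qed.

(** The decrements of a nonnegative sequence sum up to at most its first
term. *)
Lemma small_drop (f : nat -> R) M g e : (0 < M)%N -> 0 <= f M -> f 0 <= g ->
  g <= M%:R * e -> exists2 m, (m < M)%N & f m - f m.+1 <= e.
Proof.
move=> M0 fM f0 gM; apply: contrapT => none.
have step m : (m < M)%N -> f m.+1 < f m - e.
  move=> mM; rewrite ltNge; apply/negP => h; apply: none; exists m => //; lra.
have low m : (m <= M)%N -> f m <= f 0 - m%:R * e ?= iff (m == 0)%N.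
  elim: m => [|m IH] mM; first by split; rewrite ?mul0r ?subr0 ?eqxx.
  have lt : f m.+1 < f 0 - m.+1%:R * e.
    apply: lt_le_trans (step m mM) _; have [h _] := IH (ltnW mM).
    rewrite -natr1 mulrDl mul1r; lra.
  by split; rewrite ?(ltW lt) ?(lt_eqF lt).
have [_] := low M (leqnn M); rewrite gtn_eqF // => /eqP ne.
by have [h _] := low M (leqnn M); apply: ne; apply/eqP; rewrite eq_le h; lra.
Qed.

Local Notation rf := (rounding_factor C eta).

(** One iterate with small errors suffices: rounding it gives a coupling close
to it, the distance from that coupling to the iterates decreases, and so all
later iterates have small errors too. *)
Lemma errors_stay_small s T r e : (0 < s <= T)%N -> 0 < r <= 1 -> 0 < e ->
  \sum_i err s i <= r ^+ 2 -> r * rf <= e ^+ 2 ->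
  forall i, err T i <= 2 * e.
Proof.
move=> /andP[s0 sT] r01 e0 errs rG i.
have Qmu := coupling_rounded C eta mu_simplex k_gt0 (it_ge0 s).
set Q := rounded _ _ _ _ _ in Qmu.
have klQ : kl Q (G (it T)) <= e ^+ 2.
  apply: le_trans (kl_it_le Qmu sT) _; apply: le_trans rG.
  apply: kl_rounded => //; first exact: ltW.
  - exact: it_supported.
  - exact: it_balanced.
  - exact: it_total.
have [Q0 Qm] := Qmu; have dP := it_supported T.
have := kl_pinsker (fun j => supported_ge0 C eta j dP) Q0
  (fun j => coupling_gibbs_gt0 C eta Qmu dP) (it_total (leq_trans s0 sT))
  (coupling_total i0 Qmu mu_simplex) e0 klQ.
apply: le_trans; apply: le_trans (le_l1_marginal _ _ i).
by apply: ler_sum => l _; rewrite Qm.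
Qed.

Lemma mot_solutionP (eps : R) P : couplings mu P ->
  (forall Q, couplings mu Q -> inner C P <= inner C Q + eps) ->
  mot_solution C mu eps P.
Proof.
move=> Pmu opt; split=> //; rewrite -lerBlDr; apply: lb_le_inf.
  by exists (inner C P), P.
by move=> _ [Q Qmu <-]; rewrite lerBlDr; apply: opt.
Qed.

(** The regularized problem differs from the original one by the entropy, which
takes values in an interval of length [k ln n], half of [eta * eps]; the other
half is left for the divergence between the iterate and its rounding. *)
Lemma rounded_optimal (eps : R) T r : (0 < T)%N -> 0 < eps ->
  eta = (2 * k)%:R * ln n%:R / eps ->
  0 < r <= 1 -> \sum_i err T i <= r ^+ 2 ->
  r * rf <= k%:R * ln n%:R ->
  mot_solution C mu eps (rounded C eta mu k_gt0 (it T)).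
Proof.
move=> T0 eps0 etaE r01 errs rG.
have Pmu := coupling_rounded C eta mu_simplex k_gt0 (it_ge0 T).
apply: mot_solutionP => // Q Qmu.
have := kl_rounded mu_simplex k_gt0 (ltW eta_gt0) (it_supported T) (it_balanced T)
  (it_total T0) r01 errs.
set P := rounded _ _ _ _ _ in Pmu * => klP.
have := kl_it_ge0 T Qmu; have := le_trans klP rG.
rewrite (kl_gibbs C eta mu_simplex i0 Qmu (it_supported T)) (kl_gibbs C eta mu_simplex i0 Pmu (it_supported T)).
have := coupling_entropy Pmu; have := coupling_entropy_le0 Qmu.
have etaeps : eta * eps = 2 * (k%:R * ln n%:R).
  by rewrite etaE divfK ?gt_eqF // natrM mulrA.
move=> h1 h2 h3 h4; rewrite -(ler_pM2l eta_gt0) mulrDr etaeps; lra.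
Qed.

End Convergence.

(** * The program computes the iteration *)

Section Correspondence.
Variables (R : realType) (n k : nat) (C : tensor R n k) (k_gt0 : (0 < k)%N).
Variables (rl : rule k) (eps : R) (mu : 'I_k -> 'I_n -> R).
Hypothesis mu_simplex : forall i, in_simplex (mu i).
Local Notation eta := ((2 * k)%:R * ln n%:R / eps).
Local Notation i0 := (Ordinal k_gt0).
Local Notation G := (gibbs C eta).

Definition selected d t : 'I_k := result C (select k_gt0 rl eta mu d t).

Definition iterate t : 'I_k -> 'I_n -> R :=
  foldl (fun d t => result C (scaling_step k_gt0 rl eta mu d t))
    (fun _ _ => 1) (iota 0 t).

Lemma iterateS t : iterate t.+1
  = result C (scaling_step k_gt0 rl eta mu (iterate t) t).
Proof. by rewrite /iterate -(addn1 t) iotaD foldl_cat. Qed.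

Lemma result_numeral_bind c (A : Type) (f : R -> prog R n k A) :
  result C (bind (numeral R n k c) f) = result C (f c%:R).
Proof. by []. Qed.

Lemma result_un_bind o x (A : Type) (f : R -> prog R n k A) :
  result C (bind (un n k o x) f) = result C (f (eval1 o x)).
Proof. by []. Qed.

Lemma result_bin_bind o x y (A : Type) (f : R -> prog R n k A) :
  result C (bind (bin n k o x y) f) = result C (f (eval2 o x y)).
Proof. by []. Qed.

Definition rounding_scaling T : 'I_k -> 'I_n -> R :=
  foldl (fun d i => result C (rounding_step eta mu d i)) (iterate T) (enum 'I_k).

Lemma result_sinkhorn T v :
  (forall i l, v i l = mu i l - result C (marg eta (rounding_scaling T) i) l) ->
  result C (sinkhorn k_gt0 T rl eps mu) = (rounding_scaling T,
    update v i0 (fun l => v i0 l / (\sum_j `|v i0 j|) ^+ k.-1)).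
Proof.
move=> /(fun h i => funext (h i))/funext ->.
rewrite /sinkhorn !result_numeral_bind result_un_bind !result_bin_bind.
rewrite result_numeral_bind /eval1 /eval2 result_bind result_foldM -/(iterate T).
rewrite result_bind result_foldM -/(rounding_scaling T).
have vE i : result C (let! m := marg eta (rounding_scaling T) i in zipM k Defs.Sub (mu i) m)
    = fun l => mu i l - result C (marg eta (rounding_scaling T) i) l.
  by rewrite result_bind result_zipM.
rewrite result_bind result_tabulate (funext vE) vE.
rewrite result_bind result_tabulate result_bind result_sumM.
by rewrite result_bind result_powM result_bind result_zipM.
Qed.

Lemma result_scaling_step d t : result C (scaling_step k_gt0 rl eta mu d t)
  = update d (selected d t) (fun l => d (selected d t) l
      * (mu (selected d t) l / result C (marg eta d (selected d t)) l)).
Proof. rewrite /scaling_step !result_bind !result_zipM. by []. Qed.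

Lemma result_rounding_step d i : result C (rounding_step eta mu d i)
  = update d i (fun l => d i l * Num.min 1 (mu i l / result C (marg eta d i) l)).
Proof.
by rewrite /rounding_step result_bind result_bind result_numeral_bind !result_bind !result_zipM.
Qed.

Section Positive.
Hypothesis eta_gt0 : 0 < eta.

Lemma iterate_supported t : supported mu (iterate t).
Proof.
elim: t => [|t IH]; first exact: supported1.
rewrite iterateS result_scaling_step result_marg //; last by case: IH.
exact: (supported_scale C eta mu_simplex).
Qed.

Lemma iterate_scale t :
  iterate t.+1 = scale C eta mu (iterate t) (selected (iterate t) t).
Proof.
rewrite iterateS result_scaling_step result_marg //.
by case: (iterate_supported t).
Qed.

Lemma rounding_scaling_truncated T :
  rounding_scaling T = truncated C eta mu (iterate T).
Proof.
rewrite /rounding_scaling /truncated; have [+ _] := iterate_supported T.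
elim: (enum _) (iterate T) => [|i s IH] d d0 //=.
rewrite result_rounding_step result_marg // -/(truncate C eta mu d i).
by apply: IH => *; apply: truncate_ge0.
Qed.

Lemma result_sinkhorn_rounded T : result C (sinkhorn k_gt0 T rl eps mu) =
  (truncated C eta mu (iterate T),
   correction C eta mu k_gt0 (truncated C eta mu (iterate T))).
Proof.
have [d0 _] := iterate_supported T.
rewrite (result_sinkhorn (v := residual C eta mu (truncated C eta mu (iterate T)))).
  by rewrite rounding_scaling_truncated.
move=> i l; rewrite rounding_scaling_truncated result_marg // => *.
exact: truncated_ge0.
Qed.

Lemma solves_sinkhorn T :
  mot_solution C mu eps (rounded C eta mu k_gt0 (iterate T)) ->
  solves C mu eps eta (value (run C (sinkhorn k_gt0 T rl eps mu))).
Proof.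
have [d0 _] := iterate_supported T.
rewrite -/(result C _) result_sinkhorn_rounded => sol; split => // i l.
  exact: truncated_ge0.
exact: correction_ge0.
Qed.

Lemma selected_max D t : rl = Greedy D -> let d := iterate t in forall i,
  match D with
  | L1 => marginal_error C eta mu d i <= marginal_error C eta mu d (selected d t)
  | KL => kl (mu i) (marginal (G d) i)
          <= kl (mu (selected d t)) (marginal (G d) (selected d t))
  end.
Proof.
move=> rlD d i; rewrite /selected rlD /=.
pose e i := match D with
  | L1 => marginal_error C eta mu d i
  | KL => kl (mu i) (marginal (G d) i) end.
have [d0 _] := iterate_supported t.
have -> : result C (let! e0 := tabulate (fun i1 => let! m := marg eta d i1 in disc k D (mu i1) m)
    in foldM (fun best i1 => Less (e0 best) (e0 i1) (fun b => Ret (if b then i1 else best)))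
         i0 (enum 'I_k))
  = foldl (fun best i => if e best < e i then i else best) i0 (enum 'I_k).
  rewrite result_bind result_foldM result_tabulate; congr foldl.
  apply/funext => best; apply/funext => i1.
  have eE i2 : result C (let! m := marg eta d i2 in disc k D (mu i2) m) = e i2.
    rewrite result_bind result_marg // /disc result_bind result_sumM result_tabulate /e.
    case: (D) => //.
    by apply: eq_bigr => l _; rewrite distrC.
  by rewrite [LHS]/result /= !eE.
have argmax (s : seq 'I_k) b : let m := foldl (fun best i => if e best < e i then i else best) b s in
    e b <= e m /\ forall i, i \in s -> e i <= e m.
  elim: s b => [|i1 s IH] b /=; first by split.
  have [h1 h2] := IH (if e b < e i1 then i1 else b).
  have hb : e b <= e (if e b < e i1 then i1 else b) by case: ltP => // /ltW.
  have hi : e i1 <= e (if e b < e i1 then i1 else b) by case: ltP.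
  split=> [|i2]; first exact: le_trans h1.
  by rewrite inE => /orP[/eqP ->|/h2 //]; apply: le_trans h1.
have [_ /(_ i)] := argmax (enum 'I_k) i0; rewrite mem_enum => /(_ isT).
by rewrite /e; case: (D).
Qed.

End Positive.

End Correspondence.

(** * Random schedules *)

Section Covering.
Variables (R : realType) (k T : nat).
Hypothesis k_gt0 : (0 < k)%N.
Implicit Types (w : T.-tuple 'I_k) (A : {set 'I_T}).

Definition avoiding (i : 'I_k) A : {set T.-tuple 'I_k} :=
  [set w | [forall u in A, tnth w u != i]].

(** Draws at different positions are independent, so the count is a product
over the positions. *)
Lemma card_avoiding i A :
  #|avoiding i A|%:R = k%:R ^+ T * (1 - k%:R^-1) ^+ #|A| :> R.
Proof.
pose F (u : 'I_T) (j : 'I_k) : R := if u \in A then (j != i)%:R else 1.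
transitivity (\sum_w \prod_u F u (tnth w u)).
  rewrite -sum1_card natr_sum big_mkcond /=; apply: eq_bigr => w _.
  rewrite inE; case: ifPn => [/forall_inP wA|].
    rewrite big1 // => u _; rewrite /F; case: ifP => // uA.
    by rewrite wA.
  rewrite negb_forall_in => /exists_inP[u uA wu].
  by rewrite (bigD1 u) //= /F uA (negPf wu) mul0r.
rewrite (reindex (fun g : {ffun 'I_T -> 'I_k} => [tuple g u | u < T])) /=; last first.
  exists (fun w => [ffun u => tnth w u]) => [g _|w _].
    by apply/ffunP => u; rewrite ffunE tnth_mktuple.
  by apply: eq_from_tnth => u; rewrite tnth_mktuple ffunE.
under eq_bigr do under eq_bigr do rewrite tnth_mktuple.
rewrite -(bigA_distr_bigA F).
have k0 : k%:R != 0 :> R by rewrite pnatr_eq0 -lt0n.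
rewrite (eq_bigr (fun u => k%:R * (if u \in A then 1 - k%:R^-1 else 1))).
  by rewrite big_split /= prodr_const card_ord -big_mkcond prodr_const.
move=> u _; rewrite /F; case: (u \in A); last first.
  by rewrite mulr1 sumr_const card_ord.
rewrite (bigD1 i) //= eqxx add0r (eq_bigr (fun=> 1)) => [|j ->//].
rewrite sumr_const mulrBr mulr1 divff //.
have -> : #|[pred j | j != i]| = k.-1.
  by have := cardC1 i; rewrite card_ord => <-; apply: eq_card.
by rewrite -subn1 natrB.
Qed.

Variables (L M : nat).
Hypothesis LMT : (1 + M * L <= T)%N.

Definition covering w := forall m i, (m < M)%N ->
  exists2 u, (u < L)%N & nth (Ordinal k_gt0) w (1 + m * L + u) = i.

Let pos (m : 'I_M) (u : 'I_L) : 'I_T.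
refine (@Ordinal T (1 + m * L + u) _).
abstract (apply: leq_trans LMT; rewrite -addnS -addnA leq_add2l;
  apply: (@leq_trans (m.+1 * L)); [by rewrite mulSnr leq_add2l | by rewrite leq_mul2r ltn_ord orbT]).
Defined.

Let block m := [set pos m u | u : 'I_L].

Let card_block m : #|block m| = L.
Proof.
rewrite card_imset ?card_ord // => u u' /(congr1 val) /= /addnI e.
exact: val_inj.
Qed.

(** The union bound over the blocks and the indices missing from them. *)
Lemma unif_pr_covering (E : T.-tuple 'I_k -> Prop) :
  (forall w, covering w -> E w) ->
  1 - M%:R * k%:R * expR (- (L%:R / k%:R)) <= unif_pr R E.
Proof.
move=> coverE; rewrite /unif_pr card_tuple card_ord natrX.
have k0 : 0 < k%:R :> R by rewrite ltr0n.
have kT : 0 < k%:R ^+ T :> R by rewrite exprn_gt0.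
rewrite ler_pdivlMr // mulrBl mul1r lerBlDr.
have bad w : ~ E w -> exists m i, w \in avoiding i (block m).
  move=> nE; apply: contrapT => nbad; apply/nE/coverE => m i mM.
  apply: contrapT => ncov; apply: nbad; exists (Ordinal mM), i.
  rewrite inE; apply/forall_inP => _ /imsetP[u _ ->]; apply/eqP => wu.
  apply: ncov; exists u; first exact: ltn_ord.
  by rewrite -wu (tnth_nth (Ordinal k_gt0)).
set S := [set w | _]%SET.
have -> : k%:R ^+ T = \sum_(w : T.-tuple 'I_k) 1 :> R.
  by rewrite sumr_const card_tuple card_ord natrX.
apply: (@le_trans _ _ (\sum_w ((w \in S)%:R
    + \sum_(m < M) \sum_(i < k) (w \in avoiding i (block m))%:R))).
  apply: ler_sum => w _; case: (boolP (w \in S)) => wS.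
    by rewrite lerDl !sumr_ge0 // => m _; rewrite sumr_ge0.
  have /bad [m [i wmi]] : ~ E w by move=> /asboolT Ew; case/negP: wS; rewrite inE.
  rewrite add0r (bigD1 m) //= (bigD1 i) //= wmi -addrA lerDl addr_ge0 //.
    by rewrite sumr_ge0.
  by rewrite sumr_ge0 // => m' _; rewrite sumr_ge0.
have sum_ind (X : {set T.-tuple 'I_k}) : \sum_w (w \in X)%:R = #|X|%:R :> R.
  rewrite -sum1_card natr_sum [RHS]big_mkcond /=.
  by apply: eq_bigr => w _; case: (_ \in _).
rewrite big_split /= sum_ind lerD2l exchange_big /=.
under eq_bigr do rewrite exchange_big /=.
under eq_bigr do under eq_bigr do rewrite sum_ind card_avoiding card_block.
rewrite !sumr_const !card_ord.
have natl (x : R) : x *+ k *+ M = M%:R * k%:R * x.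
  by rewrite -mulrnA -(mulr_natl x) natrM (mulrC k%:R).
rewrite natl -[leRHS]mulrA ler_wpM2l ?mulr_ge0 //.
rewrite card_tuple card_ord natrX mulrC ler_pM2r //.
have -> : expR (- (L%:R / k%:R)) = expR (- k%:R^-1) ^+ L :> R.
  by rewrite -expRM_natl mulrN.
rewrite lerXn2r ?nnegrE ?expR_ge0 ?subr_ge0 ?invf_le1 ?ler1n //.
exact: expR_ge1Dx.
Qed.

End Covering.

Lemma round_robin_cover k (k_gt0 : (0 < k)%N) a (i : 'I_k) :
  exists2 u, (u < k)%N & Ordinal (ltn_pmod (a + u) k_gt0) = i.
Proof.
exists ((i + (k - a %% k)) %% k)%N; first by rewrite ltn_mod.
apply: val_inj; rewrite /= modnDmr -modnDml addnCA subnKC; last first.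
  by rewrite ltnW // ltn_mod.
by rewrite modnDr modn_small.
Qed.

(** * The case of a single state *)

Section OneState.
Variables (R : realType) (k : nat) (C : tensor R 1 k) (k_gt0 : (0 < k)%N).

Lemma result_marg0 n (C' : tensor R n k) d i :
  result C' (marg 0 d i) = fun=> 1.
Proof.
rewrite /marg result_tabulate; apply/funext => l; rewrite result_bind.
rewrite [LHS]/result /= /smin invr0 mul0e oppe0 /=.
by rewrite subr0 mul0r expR0.
Qed.

(** As the oracle answers zero whatever the weights, the computed marginals are
[1]; here this is their true value, the scaling vectors never change, and the
output is the only coupling. *)
Lemma solves_one_state rl (eps : R) mu T : 0 < eps ->
  (forall i, in_simplex (mu i)) ->
  solves C mu eps ((2 * k)%:R * ln 1%:R / eps)
    (value (run C (sinkhorn k_gt0 T rl eps mu))).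
Proof.
move=> eps0 mu_simplex.
have mu1 : mu = fun _ _ => 1.
  apply/funext => i; apply/funext => l; have [_] := mu_simplex i.
  by rewrite big_ord1 (ord1 l).
have eta0 : (2 * k)%:R * ln 1%:R / eps = 0 :> R by rewrite ln1 mulr0 mul0r.
have upd (d : 'I_k -> 'I_1 -> R) i x : d = (fun _ _ => 1) -> x = (fun=> 1) ->
    update d i x = fun _ _ => 1.
  by move=> -> ->; apply/funext => i'; rewrite /update; case: eqP.
have it1 t : iterate C k_gt0 rl eps mu t = fun _ _ => 1.
  elim: t => [|t IH] //; rewrite iterateS result_scaling_step eta0 result_marg0 IH.
  by apply: upd => //; apply/funext => l; rewrite mu1 divr1 mulr1.
have rd1 : rounding_scaling C k_gt0 rl eps mu T = fun _ _ => 1.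
  rewrite /rounding_scaling it1; elim: (enum _) => [|i s IH] //=.
  rewrite result_rounding_step eta0 result_marg0 upd //; first by rewrite eta0 in IH.
  by apply/funext => l; rewrite mu1 divr1 minxx mulr1.
rewrite -/(result C _) (result_sinkhorn (v := fun _ _ => 0)); last first.
  by move=> i l; rewrite eta0 result_marg0 mu1 subrr.
have v0 : update (fun _ _ => 0 : R) (Ordinal k_gt0) (fun l : 'I_1 =>
    0 / (\sum_(j < 1) `|0 : R|) ^+ k.-1) = fun _ _ => 0.
  by apply/funext => i; apply/funext => l; rewrite /update mul0r; case: eqP.
pose one (i : 'I_k) (l : 'I_1) : R := 1.
have repr1 j : represented C 0 one (fun _ _ => 0) j = \prod_i one i (j i).
  rewrite /represented oppr0 mul0r expR0 mulr1 [X in _ + X](_ : _ = 0) ?addr0 //.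
  by rewrite (bigD1 (Ordinal k_gt0)) //= mul0r.
rewrite v0 rd1 eta0; split=> //; apply: mot_solutionP.
  split=> [j|i l].
    by rewrite /represented addr_ge0 ?mulr_ge0 ?expR_ge0 ?prodr_ge0.
  rewrite /represented mu1.
  transitivity (marginal (fun j => \prod_i' one i' (j i')) i l); last first.
    by rewrite marginal_prod mul1r big1 // => i' _; rewrite big_ord1.
  by apply: eq_bigr => j _; apply: repr1.
move=> Q Qmu; rewrite -[leLHS]addr0 lerD //; last exact: ltW.
have innerE (P : tensor R 1 k) : inner C P = C [ffun=> ord0] * \sum_j P j.
  rewrite /inner mulr_sumr; apply: eq_bigr => j _; congr (C _ * _).
  by apply/ffunP => i; rewrite ffunE ord1.
rewrite !innerE (coupling_total (Ordinal k_gt0) Qmu mu_simplex).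
rewrite (eq_bigr (fun j : {ffun 'I_k -> 'I_1} => \prod_i one i (j i))) => [|j _].
  by rewrite total_prod big1 // => i _; rewrite big_ord1.
exact: repr1.
Qed.

End OneState.

(** * Polynomial bounds *)

Section Estimates.
Variables (R : realType) (n k : nat) (C : tensor R n k) (k_gt0 : (0 < k)%N).
Variables (eps : R) (mu : 'I_k -> 'I_n -> R) (N : nat).
Hypotheses (eps_gt0 : 0 < eps) (n_gt1 : (1 < n)%N).
Hypothesis mu_simplex : forall i, in_simplex (mu i).
Hypotheses (nkN : (n + k <= N)%N) (xN : cmax C / eps <= N%:R).
Variable rl : rule k.
Local Notation eta := ((2 * k)%:R * ln n%:R / eps).
Local Notation B := (eta * cmax C).
Local Notation X := (N%:R : R).
Local Notation nu := (X^-1).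
Local Notation it := (iterate C k_gt0 rl eps mu).
Local Notation sel t := (selected C k_gt0 rl eps mu (it t) t).
Local Notation err t i := (marginal_error C eta mu (it t) i).

Lemma ln_state_gt0 : 0 < ln n%:R :> R.
Proof. by rewrite ln_gt0 // ltr1n. Qed.

Lemma eta_gt0 : 0 < eta.
Proof.
by rewrite divr_gt0 // mulr_gt0 ?ln_state_gt0 // ltr0n muln_gt0.
Qed.

Let X3 : 3 <= X.
Proof. by rewrite ler_nat; lia. Qed.

Let N0 : (0 < N)%N. Proof. lia. Qed.

Let X0 : 0 < X. Proof. by rewrite ltr0n N0. Qed.

Let kX : k%:R + 2 <= X.
Proof. by rewrite -natrD ler_nat; lia. Qed.

Let lnX : ln n%:R <= X.
Proof.
apply: le_trans (ltW (ln_sublinear _)) _; first by rewrite ltr0n; lia.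
by rewrite ler_nat; lia.
Qed.

Let klnX : k%:R * ln n%:R <= X ^+ 2.
Proof. by rewrite expr2 ler_pM ?(ltW ln_state_gt0) //; have := kX; lra. Qed.

Let B_le : B <= 2 * X ^+ 3.
Proof.
have -> : B = 2 * (k%:R * ln n%:R * (cmax C / eps)) by rewrite natrM; ring.
rewrite ler_pM2l // exprSr ler_pM ?mulr_ge0 ?(ltW ln_state_gt0) ?cmax_ge0 //.
by rewrite invr_ge0 ltW.
Qed.

Lemma rounding_factor_le : rounding_factor C eta <= X ^+ 7.
Proof.
rewrite /rounding_factor natrD natrM.
have x3 := X3; have kx := kX; have klnx := klnX.
have b : (2 * k%:R + 2) * B <= 2 * X * (2 * X ^+ 3).
  apply: le_trans (ler_wpM2l _ B_le) _; first by rewrite addr_ge0 ?mulr_ge0.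
  by rewrite ler_wpM2r ?mulr_ge0 ?exprn_ge0 //; lra.
have X2 : 9 <= X ^+ 2 by rewrite expr2; nra.
have X4 : 81 <= X ^+ 4 by rewrite (exprD X 2 2); nra.
have X7 : 243 * X ^+ 2 <= X ^+ 7.
  rewrite (exprD X 2 5) mulrC ler_pM2l ?exprn_gt0 // exprSr; nra.
have X74 : 27 * X ^+ 4 <= X ^+ 7.
  rewrite (exprD X 4 3) mulrC ler_pM2l ?exprn_gt0 // exprSr; nra.
have XX : 2 * X * (2 * X ^+ 3) = 4 * X ^+ 4 by ring.
have : 2 * k%:R <= X ^+ 2 by rewrite expr2; nra.
lra.
Qed.

Lemma first_potential_le : k.+1%:R * ln n%:R + 2 * B <= X ^+ 5.
Proof.
have x3 := X3; have kx := kX; have ble := B_le.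
have a : k.+1%:R * ln n%:R <= X * X.
  by rewrite ler_pM ?(ltW ln_state_gt0) // -natr1; lra.
have X2 : X * X <= X ^+ 3.
  by rewrite -expr2 (exprSr X 2) ler_peMr ?exprn_ge0 //; lra.
have X5 : 9 * X ^+ 3 <= X ^+ 5.
  by rewrite (exprD X 3 2) mulrC ler_pM2l ?exprn_gt0 // expr2; nra.
have : 0 <= X ^+ 3 by rewrite exprn_ge0.
lra.
Qed.

Let nu_gt0 a : 0 < nu ^+ a. Proof. by rewrite exprn_gt0 ?invr_gt0. Qed.

Let nu_le1 a : nu ^+ a <= 1.
Proof. by rewrite exprn_ile1 ?invr_ge0 ?(ltW X0) // invf_le1 //; have := X3; lra. Qed.

Let cancel a b : nu ^+ (a + b) * X ^+ b = nu ^+ a.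
Proof. by rewrite exprD -mulrA -exprMn mulVf ?gt_eqF // expr1n mulr1. Qed.

Let sum_le (f : 'I_k -> R) a : (forall i, f i <= 2 * nu ^+ a.+2) ->
  \sum_i f i <= nu ^+ a.
Proof.
move=> fa; apply: le_trans (ler_sum _ (fun i _ => fa i)) _.
rewrite sumr_const card_ord -[_ *+ k]mulr_natl mulrA -(cancel a 2) addn2 [leRHS]mulrC.
by rewrite ler_pM2r // expr2; have := X3; have := kX; nra.
Qed.

(** Rounding an iterate whose errors sum up to [r ^ 2] costs [r * N ^ 7]. The
last rounding may cost [1 / N], which is less than [k * ln n]; so the last
errors must be of order [N ^ -18], hence the coupling obtained at [s] must have
divergence at most [N ^ -36], hence the errors at [s] must be of order
[N ^ -88]. *)
Lemma solves_of_small_error s T : (0 < s <= T)%N ->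
  (forall i, err s i <= 2 * nu ^+ 88) ->
  solves C mu eps eta (value (run C (sinkhorn k_gt0 T rl eps mu))).
Proof.
move=> sT errs; have e0 := eta_gt0.
have itS := iterate_scale C k_gt0 rl mu_simplex e0.
have nu01 a : 0 < nu ^+ a <= 1 by rewrite nu_gt0 nu_le1.
have errT : forall i, err T i <= 2 * nu ^+ 18.
  apply: (errors_stay_small k_gt0 e0 mu_simplex erefl itS sT (nu01 43)) => //.
    by rewrite -exprM; apply: sum_le.
  rewrite -exprM -(cancel (18 * 2) 7) ler_pM2l //; exact: rounding_factor_le.
apply: solves_sinkhorn => //.
apply: (rounded_optimal k_gt0 e0 mu_simplex erefl itS _ eps_gt0 erefl (nu01 8)).
- by case/andP: sT; apply: leq_trans.
- by rewrite -exprM; apply: sum_le.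
apply: (@le_trans _ _ nu).
  by rewrite -[leRHS]expr1 -(cancel 1 7) ler_pM2l //; exact: rounding_factor_le.
apply: (@le_trans _ _ (ln 2)).
  have : ln (1 + - (1 / 2)) <= - (1 / 2) :> R by apply: le_ln1Dx; lra.
  have -> : 1 + - (1 / 2) = 2^-1 :> R by field.
  rewrite lnV ?posrE //.
  have : nu <= 3^-1 by rewrite lef_pV2 ?posrE.
  lra.
rewrite -[leLHS]mul1r ler_pM ?ln_ge0 ?ler1n // ?ler_ln ?posrE ?ltr0n ?ler_nat //; lra || lia.
Qed.

(** The potential is at most [N ^ 5] after the first iteration, and
[N ^ 5 = N ^ 197 * N ^ -192]. *)
Lemma quiet_block L : exists2 m, (m < N ^ 197)%N &
  exists2 Q, couplings mu Q
  & kl Q (gibbs C eta (it (1 + m * L)))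
    - kl Q (gibbs C eta (it (1 + m * L + L))) <= (nu ^+ 96) ^+ 2.
Proof.
have e0 := eta_gt0; have itS := iterate_scale C k_gt0 rl mu_simplex e0.
have [d0 _] := iterate_supported C k_gt0 rl mu_simplex e0 0.
have Qmu := coupling_rounded C eta mu_simplex k_gt0 d0.
set Q := rounded _ _ _ _ _ in Qmu.
have [||||m mM small] := @small_drop _
    (fun m => kl Q (gibbs C eta (it (1 + m * L)))) (N ^ 197) (X ^+ 5) ((nu ^+ 96) ^+ 2).
- by rewrite expn_gt0 N0.
- exact: (kl_it_ge0 mu_simplex erefl itS).
- rewrite mul0n addn0; apply: le_trans first_potential_le.
  exact: (kl_first k_gt0 e0 mu_simplex erefl itS).
- rewrite -exprM natrX (exprD X 5 (96 * 2)) -mulrA [_ * nu ^+ _]mulrC.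
  by rewrite (cancel 0 (96 * 2)) expr0 mulr1.
exists m => //; exists Q => //.
by rewrite (mulSnr m) (addnA 1) in small.
Qed.

Lemma solves_covering (sigma : nat -> 'I_k) T : rl = Schedule sigma ->
  (1 + N ^ 197 * N ^ 8 <= T)%N ->
  (forall m i, (m < N ^ 197)%N ->
    exists2 u, (u < N ^ 8)%N & sigma (1 + m * N ^ 8 + u)%N = i) ->
  solves C mu eps eta (value (run C (sinkhorn k_gt0 T rl eps mu))).
Proof.
move=> rlE NT cover; have e0 := eta_gt0.
have itS := iterate_scale C k_gt0 rl mu_simplex e0.
have [m mM [Q Qmu small]] := quiet_block (N ^ 8).
have selE t : sel t = sigma t by rewrite /selected rlE.
apply: (@solves_of_small_error (1 + m * N ^ 8)).
  by rewrite /= (leq_trans _ NT) // leq_add2l leq_mul2r ltnW ?orbT.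
move=> i; rewrite -(cancel 88 8) -natrX mulrA.
apply: (covering_small_error mu_simplex erefl itS Qmu _ _ small) => // i'.
by have [u uL uE] := cover m i' mM; exists u; rewrite ?selE.
Qed.

Lemma solves_greedy D T : rl = Greedy D -> (1 + N ^ 197 * N ^ 8 <= T)%N ->
  solves C mu eps eta (value (run C (sinkhorn k_gt0 T rl eps mu))).
Proof.
move=> rlE NT; have e0 := eta_gt0.
have itS := iterate_scale C k_gt0 rl mu_simplex e0.
have [m mM [Q Qmu]] := quiet_block 1.
rewrite muln1 addn1 (kl_it mu_simplex erefl itS _ Qmu) opprB addrC subrK => small.
apply: (@solves_of_small_error (1 + m)).
  rewrite /= (leq_trans _ NT) // leq_add2l (leq_trans (ltnW mM)) // leq_pmulr //.
  by rewrite expn_gt0 N0.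
move=> i; apply: (@le_trans _ _ (2 * nu ^+ 96)).
  apply: (greedy_small_error (D := D) mu_simplex erefl itS _ _ small) => //.
  exact: (selected_max C k_gt0 mu_simplex e0 _ rlE).
rewrite ler_pM2l // (exprD nu 88 8) ler_piMr // ltW //.
Qed.

End Estimates.

(** * Size parameters and the main result *)

Section Size.
Variables (R : realType) (n k : nat) (y : R).
Hypotheses (n_gt0 : (0 < n)%N) (k_gt0 : (0 < k)%N) (y_ge0 : 0 <= y).
Local Notation S := (n%:R + k%:R + y).

(** Iteration counts are powers of this natural number; that it is at most
the square of the real parameter allows going back to the latter. *)
Definition size_bound : nat := (Num.truncn S).+1.
Local Notation N := size_bound.

Let S2 : 2 <= S.
Proof.
have : 2 <= (n + k)%:R :> R by rewrite ler_nat; lia.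
by rewrite (natrD _ n k) => h; have := y_ge0; lra.
Qed.

Let S0 : 0 <= S. Proof. by have := S2; lra. Qed.

Lemma lt_size_bound : S < N%:R.
Proof. by have /andP[] := truncn_itv S0. Qed.

Lemma size_bound_nk : (n + k <= N)%N.
Proof.
by rewrite -(ler_nat R) natrD; apply: le_trans (ltW lt_size_bound); rewrite lerDl.
Qed.

Lemma size_bound_y : y <= N%:R.
Proof. by apply: le_trans (ltW lt_size_bound); rewrite lerDr. Qed.

Lemma size_bound_ge3 : (3 <= N)%N.
Proof. by rewrite /size_bound ltnS truncn_ge_nat. Qed.

Lemma size_bound_le : N%:R <= S ^+ 2.
Proof.
have : (Num.truncn S)%:R <= S by rewrite truncn_le.
by rewrite /size_bound -natr1 expr2 => h; have := S2; nra.
Qed.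

Lemma size_bound_poly a : (0 < a)%N -> (N ^ a)%:R <= poly_bound (2 * a) n k y.
Proof.
move=> a0; rewrite /poly_bound natrX.
apply: (@le_trans _ _ (S ^+ (2 * a))).
  by rewrite exprM lerXn2r ?nnegrE ?exprn_ge0 // size_bound_le.
by rewrite ler_peMl ?exprn_ge0 // ler1n muln_gt0.
Qed.

Local Notation T := (Num.truncn (poly_bound (2 * 206) n k y)).

Lemma iterations_ge : (1 + N ^ 197 * N ^ 8 <= T)%N.
Proof.
have N3 := size_bound_ge3.
apply: (@leq_trans (N ^ 206)).
  rewrite -expnD (expnD N 1 205) expn1.
  apply: (@leq_trans (2 * N ^ 205)).
    by rewrite mul2n -addnn leq_add2r expn_gt0 (ltnW (ltnW N3)).
  by rewrite leq_mul2r (ltnW N3) orbT.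
rewrite truncn_ge_nat; first exact: size_bound_poly.
by rewrite mulr_ge0 ?exprn_ge0.
Qed.

Lemma iterations_le : (T <= N ^ (6 + 2 * 206))%N.
Proof.
have N3 := size_bound_ge3.
rewrite -(ler_nat R); apply: le_trans (_ : poly_bound (2 * 206) n k y <= _).
  by rewrite truncn_le mulr_ge0 ?exprn_ge0.
rewrite /poly_bound expnD (natrM _ (N ^ 6)) ler_pM ?exprn_ge0 //.
  rewrite ler_nat (@leq_trans (3 ^ 6)) // leq_exp2r //.
by rewrite natrX lerXn2r ?nnegrE // ltW // lt_size_bound.
Qed.

(* Costs are bounded by following their expression; an addition raises the
   exponent by one because [2 <= N]. *)
Let smallD p q a b : (a <= N ^ p)%N -> (b <= N ^ q)%N ->
  (a + b <= N ^ (maxn p q).+1)%N.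
Proof.
move=> ap bq; have N3 := size_bound_ge3.
have le_max r : (r <= maxn p q)%N -> (N ^ r <= N ^ maxn p q)%N.
  by move=> h; rewrite leq_pexp2l.
rewrite expnS (@leq_trans (2 * N ^ maxn p q)) //; last by rewrite leq_mul2r (ltnW N3) orbT.
by rewrite mul2n -addnn leq_add ?(leq_trans ap) ?(leq_trans bq) ?le_max ?leq_maxl ?leq_maxr.
Qed.

Let smallM p q a b : (a <= N ^ p)%N -> (b <= N ^ q)%N ->
  (a * b <= N ^ (p + q))%N.
Proof. by move=> ap bq; rewrite expnD leq_mul. Qed.

Let small_digit a : (a <= 9)%N -> (a <= N ^ 2)%N.
Proof.
by move=> a9; apply: leq_trans a9 _; rewrite (@leq_trans (3 ^ 2)) // leq_exp2r // size_bound_ge3.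
Qed.

Lemma cost_sinkhorn (C : tensor R n k) rl eps mu :
  cost_le ((2 * k)%:R * ln n%:R / eps) (poly_bound (2 * 430) n k y)
    (run C (sinkhorn k_gt0 T rl eps mu)).
Proof.
apply: frugal_cost_le (frugal_sinkhorn C k_gt0 T rl eps mu) _.
apply: le_trans (size_bound_poly (a := 430) isT); rewrite ler_nat.
have nk := size_bound_nk.
have sn : (n <= N ^ 1)%N by rewrite expn1; lia.
have sn1 : (n.+1 <= N ^ 1)%N by rewrite expn1; lia.
have sk : (k <= N ^ 1)%N by rewrite expn1; lia.
have sk1 : (k.-1.+1 <= N ^ 1)%N by rewrite expn1; lia.
have s1 := @small_digit 1 isT; have s4 := @small_digit 4 isT.
have s5 := @small_digit 5 isT; have s6 := @small_digit 6 isT.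
have marg := smallM sn (smallD (smallM sk (smallM sn s4)) s5).
have step := smallD
  (smallD (smallM sk (smallD marg (smallD (smallM sn s5) sn1))) (smallM sk s1))
  (smallD marg (smallD sn sn)).
have rounding := smallM sk (smallD marg (smallD sn (smallD s1 (smallD sn sn)))).
have output := smallD (smallM sk (smallD marg sn))
  (smallD (smallM sn s1) (smallD sn1 (smallD sk1 sn))).
apply: leq_trans (smallD s6 (smallD (smallM iterations_le step) (smallD rounding output))) _.
by rewrite leq_pexp2l // (leq_trans _ size_bound_ge3).
Qed.

(** The number of events in the union bound is at most [expR (198 * N)], while
each of them has probability at most [delta * expR (- 198 * N)]. *)
Lemma covering_probability (delta : R) : 0 < delta -> ln delta^-1 <= y ->
  (N ^ 197)%:R * k%:R * expR (- ((N ^ 8)%:R / k%:R)) <= delta.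
Proof.
move=> d0 dy; set X : R := N%:R.
have X3 : 3 <= X by rewrite ler_nat size_bound_ge3.
have X0 : 0 < X by lra.
have yX : y <= X := size_bound_y.
have le_expR (t : R) : t <= expR t.
  by apply: le_trans (expR_ge1Dx t); lra.
have kX : k%:R <= X by rewrite ler_nat; apply: leq_trans size_bound_nk; rewrite leq_addl.
have k0 : 0 < k%:R :> R by rewrite ltr0n.
rewrite natrX natrX -/X.
apply: (@le_trans _ _ (expR X ^+ 197 * expR X * expR (- (X ^+ 8 / k%:R)))).
  rewrite ler_wpM2r ?expR_ge0 // ler_pM ?exprn_ge0 ?(ltW X0) ?(ltW k0) //.
    by rewrite lerXn2r ?nnegrE ?expR_ge0 ?(ltW X0) // le_expR.
  exact: le_trans kX (le_expR X).
rewrite -expRM_natl -!expRD -[leRHS]lnK ?posrE // ler_expR.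
have : X ^+ 7 <= X ^+ 8 / k%:R.
  by rewrite ler_pdivlMr // (exprSr X 7) ler_wpM2l ?exprn_ge0 // ltW.
have : 243 * X <= X ^+ 7.
  rewrite (exprSr X 6) ler_wpM2r ?(ltW X0) //.
  apply: (@le_trans _ _ (3 ^+ 6)); first by rewrite -natrX ler_nat.
  by rewrite lerXn2r ?nnegrE ?(ltW X0).
have : ln delta^-1 = - ln delta by rewrite lnV.
lra.
Qed.

End Size.

Theorem theorem4p18 (R : realType) :
  exists a b : nat,
  forall (n k : nat) (k_gt0 : (0 < k)%N) (C : tensor R n k) (eps : R)
         (mu : 'I_k -> 'I_n -> R),
  0 < eps -> (forall i, in_simplex (mu i)) ->
  let eta := (2 * k)%:R * ln n%:R / eps in
  let x := cmax C / eps in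
  (forall rl : rule k,
     rl = round_robin k_gt0 \/ (exists D, rl = Greedy D) ->
     let T := Num.truncn (poly_bound a n k x) in
     let r := run C (sinkhorn k_gt0 T rl eps mu) in
     solves C mu eps eta (value r) /\ cost_le eta (poly_bound b n k x) r)
  /\
  (forall delta : R, 0 < delta < 1 ->
     let y := x + ln delta^-1 in
     let T := Num.truncn (poly_bound a n k y) in
     let r := fun w : T.-tuple 'I_k =>
                run C (sinkhorn k_gt0 T (drawn k_gt0 w) eps mu) in
     1 - delta <= unif_pr R (fun w => solves C mu eps eta (value (r w)))
     /\ forall w, cost_le eta (poly_bound b n k y) (r w)).
Proof.
(* [N ^ 206] iterations leave room for the first one and for [N ^ 197] blocks of
   length [N ^ 8]; they cost at most [N ^ 430]; and [N] is at most the square of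
   the base of the polynomial bounds *)
exists (2 * 206)%N, (2 * 430)%N => n k k_gt0 C eps mu eps0 mu_simplex eta x.
have n_gt0 := simplex_dim_gt0 (mu_simplex (Ordinal k_gt0)).
have x0 : 0 <= x by rewrite divr_ge0 ?cmax_ge0 // ltW.
have one_state : n = 1%N -> forall T rl,
    solves C mu eps eta (value (run C (sinkhorn k_gt0 T rl eps mu))).
  move=> n1 T rl; rewrite /eta; move: C mu mu_simplex {eta x x0}.
  by rewrite n1 => C mu mu_simplex; apply: solves_one_state.
split=> [rl rlE T r|delta /andP[d0 d1] y T r].
  split; last exact: cost_sinkhorn.
  have [/one_state-/(_ T rl) //|n1] := eqVneq n 1%N.
  have {}n1 : (1 < n)%N by rewrite ltn_neqAle eq_sym n1.
  have nkN := size_bound_nk n_gt0 k_gt0 x0; have xN := size_bound_y n_gt0 k_gt0 x0.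
  have NT := iterations_ge n_gt0 k_gt0 x0.
  case: rlE => [rlE|[D rlE]]; last exact: (solves_greedy k_gt0 eps0 n1 mu_simplex nkN xN rlE NT).
  apply: (solves_covering k_gt0 eps0 n1 mu_simplex nkN xN rlE NT) => m i _.
  have [u uk uE] := round_robin_cover k_gt0 (1 + m * size_bound n k x ^ 8) i.
  exists u => //; apply: leq_trans uk _.
  rewrite (@leq_trans (size_bound n k x)) //; first exact: leq_trans (leq_addl _ _) nkN.
  by rewrite -[leqLHS]expn1 leq_pexp2l.
have y0 : 0 <= y by rewrite addr_ge0 // ln_ge0 // invf_ge1 // ltW.
split=> [|w]; last exact: cost_sinkhorn.
have [n1|n1] := eqVneq n 1%N.
  rewrite /unif_pr (_ : [set w : _ | _]%SET = [set: T.-tuple 'I_k]%SET); last first.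
    by apply/setP => w; rewrite !inE; apply/asboolP; apply: one_state.
  rewrite cardsT divff; first by lra.
  by rewrite pnatr_eq0 card_tuple card_ord -lt0n expn_gt0 k_gt0.
have {}n1 : (1 < n)%N by rewrite ltn_neqAle eq_sym n1.
have nkN := size_bound_nk n_gt0 k_gt0 y0; have yN := size_bound_y n_gt0 k_gt0 y0.
have xN : x <= (size_bound n k y)%:R.
  by apply: le_trans yN; rewrite lerDl ln_ge0 // invf_ge1 // ltW.
have NT := iterations_ge n_gt0 k_gt0 y0.
apply: le_trans (unif_pr_covering (k_gt0 := k_gt0) R NT _).
  by rewrite lerD2l lerN2; apply: covering_probability => //; rewrite lerDr.
move=> w cover; apply: (solves_covering k_gt0 eps0 n1 mu_simplex nkN xN erefl NT) => m i.
exact: cover.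
Qed.
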